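(* For all simplicial sets $X$, $Y$, $Z$ the following identities of maps hold: $$\tilde H_{X\times Y,Z}\,\nabla_{X,Y\times Z}=\nabla_{X,Y\times Z}\,(1\otimes\tilde H_{Y,Z})\colon C(X)\otimes C(Y\times Z)\to C(X\times Y\times Z),$$ $$\tilde H_{X,Y\times Z}\,\nabla_{X\times Y,Z}=\nabla_{X\times Y,Z}\,(\tilde H_{X,Y}\otimes1)\colon C(X\times Y)\otimes C(Z)\to C(X\times Y\times Z).$$
   Context: $\Bbbk$ is a commutative ring with unit; $C(X)$ is the normalized chain complex of a simplicial set $X$ over $\Bbbk$. The Koszul sign rule is used, e.g. $(1\otimes h)(x\otimes c)=(-1)^{|h||x|}x\otimes h(c)$. For a simplex $x$ write $\partial_p^qx=\partial_p\partial_{p+1}\cdots\partial_qx$ for $p\le q$ and $\partial_p^{p-1}x=x$. For a set $\alpha=\{\alpha_1<\dots<\alpha_p\}$ of non-negative integers write $s_\alpha x=s_{\alpha_p}\cdots s_{\alpha_1}x$, $s_\emptyset x=x$. A $(p,q)$-shuffle $(\alpha,\beta)\vdash(p,q)$ is a partition of $\{0,\dots,p+q-1\}$ into sets $\alpha,\beta$ of sizes $p,q$; $(-1)^{(\alpha,\beta)}$ is the sign of the permutation $(\alpha_1<\dots<\alpha_p,\beta_1<\dots<\beta_q)$. The shuffle map is $\nabla_{X,Y}\colon C(X)\otimes C(Y)\to C(X\times Y)$, $\nabla(x\otimes y)=\sum_{(\alpha,\beta)\vdash(p,q)}(-1)^{(\alpha,\beta)}(s_\beta x,s_\alpha y)$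 for $p=|x|$, $q=|y|$. The map $\tilde H_{X,Y}\colon C(X\times Y)\to C(X\times Y)$ (degree $+1$) is, for $(x,y)\in X_n\times Y_n$, $$\tilde H(x,y)=\sum_{p,q\ge0,\;p+q<n}\ \sum_{(\alpha,\beta)\vdash(p,q+1)}(-1)^{p+q+(\alpha,\beta)}\bigl(s_\beta\,\partial_{p+1}^{p+q}x,\ s_{p+q+1}s_\alpha\,\partial_0^{p-1}y\bigr).$$ $\tilde H_{X\times Y,Z}$ and $\tilde H_{X,Y\times Z}$ (and similarly the $\nabla$ maps) arise from regarding $X\times Y\times Z$ as $(X\times Y)\times Z$ and $X\times(Y\times Z)$, respectively. *)

(* Defs.v *)
From HB Require Import structures.
From mathcomp Require Import all_boot all_order all_algebra all_fingroup.
From mathcomp Require Import finmap.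
From mathcomp Require Import all_classical.
From mathcomp Require Import zify.

Set Implicit Arguments.
Unset Strict Implicit.
Unset Printing Implicit Defensive.

Import GRing.Theory.
Local Open Scope classical_set_scope.
Local Open Scope ring_scope.

(* The free k-module on T, as finitely supported functions T -> k. *)
Section FreeModule.
Variables (k : pzRingType) (T : choiceType).

Definition fin_supp : {pred T -> k^o} :=
  fun c => `[< finite_set [set x | c x != 0] >].

Fact fin_supp_submod : submod_closed fin_supp.
Proof.
split=> [|a u v /asboolP fu /asboolP fv]; apply/asboolP.
  by apply: (sub_finite_set _ (finite_set0 T)) => x /=; rewrite eqxx.
have fuv : finite_set ([set x | u x != 0] `|` [set x | v x != 0]).
  by rewrite finite_setU.
apply: (sub_finite_set _ fuv) => x /= nz.
have [u0|] := eqVneq (u x) 0; last by left.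
right; apply: contra_neq nz => v0.
by rewrite (_ : _ x = a * u x + v x) // u0 v0 mulr0 addr0.
Qed.
HB.instance Definition _ := GRing.isSubmodClosed.Build k (T -> k^o) fin_supp
  fin_supp_submod.

Record freemod := FreeMod { coef :> T -> k^o; _ : coef \in fin_supp }.
HB.instance Definition _ := [isSub for coef].
HB.instance Definition _ := [Choice of freemod by <:].
HB.instance Definition _ := [SubChoice_isSubLmodule of freemod by <:].

Lemma coef_finite (c : freemod) : finite_set [set x | c x != 0].
Proof. by case: c => c /= /asboolP. Qed.

Fact freegen_subproof (x : T) :
  (fun y => (y == x)%:R : k^o) \in fin_supp.
Proof.
apply/asboolP; apply: (sub_finite_set _ (finite_set1 x)) => y /=.
by apply: contra_neqP => /eqP/negPf ->.
Qed.
Definition freegen (x : T) : freemod := FreeMod (freegen_subproof x).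

Section Lift.
Variables (M : lmodType k) (f : T -> M).

Definition freelift (c : freemod) : M := \sum_(x \in [set: T]) (c x : k) *: f x.

Lemma freelift_sub (A : set T) (c : freemod) : finite_set A ->
  [set x | c x != 0] `<=` A -> freelift c = \sum_(x \in A) (c x : k) *: f x.
Proof.
move=> fA cA; rewrite /freelift; apply/esym/fsbig_widen => // x [_ /= nA].
have [->|c0] := eqVneq (c x) 0; first by rewrite scale0r.
by case: nA; apply: cA.
Qed.

Fact freelift_linear : linear freelift.
Proof.
move=> a u v; set A := [set x | u x != 0] `|` [set x | v x != 0].
have fA : finite_set A by rewrite finite_setU; split; exact: coef_finite.
rewrite !(@freelift_sub A) //.
- rewrite !fsbig_finite //= scaler_sumr -big_split; apply: eq_bigr => x _ /=.
  by rewrite scalerDl scalerA.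
- by move=> x; right.
- by move=> x; left.
- move=> x /= nz; have [u0|] := eqVneq (u x) 0; last by left.
  right; apply: contra_neq nz => v0.
  by rewrite (_ : _ x = a * u x + v x) // u0 v0 mulr0 addr0.
Qed.
HB.instance Definition _ :=
  GRing.isLinear.Build k freemod M *:%R freelift freelift_linear.

Lemma freelift_gen x : freelift (freegen x) = f x.
Proof.
rewrite (@freelift_sub [set x]) ?fsbig_set1 /= ?eqxx ?scale1r // => y /=.
by apply: contra_neqP => /eqP/negPf ->.
Qed.
End Lift.

Lemma freelift_genK c : freelift freegen c = c.
Proof.
have [A cA fA] : exists2 A : set T, [set x | c x != 0] `<=` A & finite_set A.
  by exists [set x | c x != 0] => //; exact: coef_finite.
apply/val_inj/funext => y /=; rewrite (freelift_sub _ fA cA) fsbig_finite //=.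
rewrite -[coef _]/(val _) (raddf_sum (val : freemod -> T -> k^o)) fct_sumE.
transitivity (\sum_(x <- fset_set A) (c x : k) * (y == x)%:R).
  exact: eq_bigr.
have [yA|yA] := boolP (y \in fset_set A).
  rewrite (bigD1_seq y) //= ?eqxx ?mulr1 ?big1 ?addr0 ?fset_uniq // => x.
  by rewrite eq_sym => /negPf ->; rewrite mulr0.
have c0 : c y = 0.
  apply/eqP; apply: contraNT yA => cy; rewrite in_fset_set // inE; exact: cA.
rewrite c0 big1_seq // => x /andP[_ xA].
by case: eqVneq yA => [->|]; rewrite ?xA // mulr0.
Qed.
End FreeModule.
Arguments freegen k {T}.

Section Span.
Variables (k : pzRingType) (V : lmodType k).

Variable S : set V.

Inductive span_ind : V -> Prop :=
| span_gen v : S v -> span_ind v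
| span_zero : span_ind 0
| span_lin a u v : span_ind u -> span_ind v -> span_ind (a *: u + v).

Definition lspan : {pred V} := fun v => `[< span_ind v >].

Fact span_submod : submod_closed lspan.
Proof.
split=> [|a u v /asboolP Su /asboolP Sv]; apply/asboolP; first exact: span_zero.
exact: span_lin.
Qed.
HB.instance Definition _ := GRing.isSubmodClosed.Build k V lspan span_submod.

End Span.

(* The quotient of V by the submodule generated by S. *)
Section Quotient.
Variables (k : pzRingType) (V : lmodType k) (S : set V).

Definition quotmod : Type := Quotient.quot (lspan S).
HB.instance Definition _ := GRing.Zmodule.on quotmod.

Definition qpi (v : V) : quotmod := (\pi_(Quotient.quot (lspan S)) v)%qT.

Definition qrepr (q : quotmod) : V :=
  generic_quotient.repr (q : Quotient.quot (lspan S)).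

Lemma qreprK q : qpi (qrepr q) = q.
Proof. exact: generic_quotient.reprK. Qed.

Lemma qpi_eq u v : (qpi u = qpi v) <-> u - v \in lspan S.
Proof. by rewrite Quotient.idealrBE; split=> /eqP. Qed.

Fact qpi_zmod_morphism : zmod_morphism qpi.
Proof. by move=> u v; exact: (raddfB (\pi_(Quotient.quot (lspan S)))%qT). Qed.
HB.instance Definition _ :=
  GRing.isZmodMorphism.Build V quotmod qpi qpi_zmod_morphism.

Definition qscale (a : k) (q : quotmod) : quotmod := qpi (a *: qrepr q).

Lemma qscale_pi a v : qscale a (qpi v) = qpi (a *: v).
Proof.
by apply/qpi_eq; rewrite -scalerBr rpredZ //; apply/qpi_eq; rewrite qreprK.
Qed.

Fact qscaleA a b q : qscale a (qscale b q) = qscale (a * b) q.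
Proof. by rewrite -[q]qreprK !qscale_pi scalerA. Qed.
Fact qscale0 q : qscale 0 q = 0.
Proof. by rewrite -[q]qreprK qscale_pi scale0r raddf0. Qed.
Fact qscale1 : left_id 1 qscale.
Proof. by move=> q; rewrite -[q]qreprK qscale_pi scale1r. Qed.
Fact qscaleDr : right_distributive qscale +%R.
Proof.
move=> a p q; rewrite -[p]qreprK -[q]qreprK -raddfD !qscale_pi.
by rewrite scalerDr raddfD.
Qed.
Fact qscaleDl q : {morph qscale^~ q : a b / a + b}.
Proof. by move=> a b; rewrite -[q]qreprK !qscale_pi scalerDl raddfD. Qed.
HB.instance Definition _ := GRing.Zmodule_isLmodule.Build k quotmod
  qscaleA qscale1 qscaleDr qscaleDl.

Fact qpi_scalable : scalable qpi.
Proof. by move=> a v; rewrite -qscale_pi. Qed.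
HB.instance Definition _ :=
  GRing.isScalable.Build k V quotmod *:%R qpi qpi_scalable.

Section Lift.
Variables (M : lmodType k) (f : {linear V -> M}).

Definition qlift (_ : forall v, v \in lspan S -> f v = 0) (q : quotmod) : M :=
  f (qrepr q).

Hypothesis f0 : forall v, v \in lspan S -> f v = 0.

Lemma qlift_pi v : qlift f0 (qpi v) = f v.
Proof.
apply/eqP; rewrite -subr_eq0 -linearB; apply/eqP/f0/qpi_eq.
exact: qreprK.
Qed.

Fact qlift_linear : linear (qlift f0).
Proof.
move=> a p q; rewrite -[p]qreprK -[q]qreprK -linearP !qlift_pi.
by rewrite linearP.
Qed.
HB.instance Definition _ :=
  GRing.isLinear.Build k quotmod M *:%R (qlift f0) qlift_linear.
End Lift.
End Quotient.
Arguments qpi {k V} S.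

Lemma span_ker (k : pzRingType) (V M : lmodType k) (S : set V)
    (f : {linear V -> M}) :
  (forall v, S v -> f v = 0) -> forall v, v \in lspan S -> f v = 0.
Proof.
move=> f0 v /asboolP; elim=> [u /f0 //||a u w _ fu _ fw].
  exact: linear0.
by rewrite linearP fu fw scaler0 addr0.
Qed.

(* The tensor product over k, as the free module on M * N modulo the relations
   making (x, y) |-> tens x y bilinear. tensor_lift is its universal
   property. *)
Section Tensor.
Variables (k : comPzRingType) (M N : lmodType k).

Inductive bilin_rel : freemod k (M * N)%type -> Prop :=
| bilin_l a x x' y : bilin_rel (freegen k (a *: x + x', y)
    - (a *: freegen k (x, y) + freegen k (x', y)))
| bilin_r a x y y' : bilin_rel (freegen k (x, a *: y + y')
    - (a *: freegen k (x, y) + freegen k (x, y'))).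

Definition tensor := quotmod bilin_rel.
HB.instance Definition _ := GRing.Lmodule.on tensor.

Definition tens (x : M) (y : N) : tensor := qpi bilin_rel (freegen k (x, y)).

Lemma tens_linear_l y : linear (tens^~ y).
Proof.
move=> a x x'; rewrite /tens -linearP; apply/qpi_eq/asboolP/span_gen.
exact: bilin_l.
Qed.
Lemma tens_linear_r x : linear (tens x).
Proof.
move=> a y y'; rewrite /tens -linearP; apply/qpi_eq/asboolP/span_gen.
exact: bilin_r.
Qed.

Section Lift.
Variables (P : lmodType k) (b : M -> N -> P).
Hypotheses (bl : forall y, linear (b^~ y)) (br : forall x, linear (b x)).

Fact tensor_lift_subproof : forall v, v \in lspan bilin_rel ->
  freelift (fun xy : M * N => b xy.1 xy.2) v = 0.
Proof.
apply: (@span_ker _ _ _ bilin_rel) => v [] *.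
  by rewrite linearB linearP /= !freelift_gen /= bl subrr.
by rewrite linearB linearP /= !freelift_gen /= br subrr.
Qed.

Definition tensor_lift : tensor -> P := qlift tensor_lift_subproof.
HB.instance Definition _ := GRing.Linear.on tensor_lift.

Lemma tensor_liftE x y : tensor_lift (tens x y) = b x y.
Proof. by rewrite /tensor_lift /tens qlift_pi /= freelift_gen. Qed.
End Lift.
End Tensor.
Arguments tens {k M N}.

Section TensorMap.
Variables (k : comPzRingType) (M N M' N' : lmodType k).
Variables (f : {linear M -> M'}) (g : {linear N -> N'}).

Fact tmap_linear_l y : linear ((fun x y => tens (f x) (g y))^~ y).
Proof. by move=> a x x' /=; rewrite linearP tens_linear_l. Qed.
Fact tmap_linear_r x : linear ((fun x y => tens (f x) (g y)) x).
Proof. by move=> a y y' /=; rewrite linearP tens_linear_r. Qed.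

Definition tmap : tensor M N -> tensor M' N' :=
  tensor_lift tmap_linear_l tmap_linear_r.
HB.instance Definition _ := GRing.Linear.on tmap.

Lemma tmapE x y : tmap (tens x y) = tens (f x) (g y).
Proof. exact: tensor_liftE. Qed.
End TensorMap.

Local Open Scope nat_scope.

(* All the arguments of inord in the simplicial identities are in range, so that
   inord i is the ordinal of value i. *)
Record sset := SSet {
  simp :> nat -> Type;
  face : forall n, 'I_n.+2 -> simp n.+1 -> simp n;
  degen : forall n, 'I_n.+1 -> simp n -> simp n.+1;
  face_face : forall n i j (x : simp n.+2), i < j <= n.+2 ->
    face (inord i) (face (inord j) x) = face (inord j.-1) (face (inord i) x);
  face_degen_lt : forall n i j (x : simp n.+1), i < j <= n.+1 ->
    face (inord i) (degen (inord j) x) = degen (inord j.-1) (face (inord i) x);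
  face_degen_id : forall n j (x : simp n), j <= n ->
    face (inord j) (degen (inord j) x) = x;
  face_degen_succ : forall n j (x : simp n), j <= n ->
    face (inord j.+1) (degen (inord j) x) = x;
  face_degen_gt : forall n i j (x : simp n.+1), j.+1 < i <= n.+2 ->
    face (inord i) (degen (inord j) x) = degen (inord j) (face (inord i.-1) x);
  degen_degen : forall n i j (x : simp n), i <= j <= n ->
    degen (inord i) (degen (inord j) x) =
    degen (inord j.+1) (degen (inord i) x)
}.
Arguments face {s n}.
Arguments degen {s n}.

Record smap (X Y : sset) := SMap {
  smap_fun :> forall n, X n -> Y n;
  smap_face : forall n (i : 'I_n.+2) x,
    smap_fun (face i x) = face i (smap_fun x);
  smap_degen : forall n (i : 'I_n.+1) x,
    smap_fun (degen i x) = degen i (smap_fun x)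
}.

Section Product.
Variables X Y : sset.

Let psimp n := (X n * Y n)%type.
Let pface n (i : 'I_n.+2) (x : psimp n.+1) : psimp n :=
  (face i x.1, face i x.2).
Let pdegen n (i : 'I_n.+1) (x : psimp n) : psimp n.+1 :=
  (degen i x.1, degen i x.2).

Program Definition sprod := @SSet psimp pface pdegen _ _ _ _ _ _.
Next Obligation. by move=> n i j x ij; congr pair; exact: face_face. Qed.
Next Obligation. by move=> n i j x ij; congr pair; exact: face_degen_lt. Qed.
Next Obligation.
by move=> n j [x y] jn; congr pair; exact: face_degen_id.
Qed.
Next Obligation.
by move=> n j [x y] jn; congr pair; exact: face_degen_succ.
Qed.
Next Obligation. by move=> n i j x ij; congr pair; exact: face_degen_gt. Qed.
Next Obligation. by move=> n i j x ij; congr pair; exact: degen_degen. Qed.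
End Product.
Notation "X \xs Y" := (sprod X Y) (at level 40, left associativity).

Program Definition sassoc X Y Z : smap (X \xs (Y \xs Z)) ((X \xs Y) \xs Z) :=
  @SMap (X \xs (Y \xs Z)) ((X \xs Y) \xs Z)
    (fun n x => ((x.1, x.2.1), x.2.2)) _ _.
Next Obligation. by []. Qed.
Next Obligation. by []. Qed.

Program Definition sassocV X Y Z : smap ((X \xs Y) \xs Z) (X \xs (Y \xs Z)) :=
  @SMap ((X \xs Y) \xs Z) (X \xs (Y \xs Z))
    (fun n x => (x.1.1, (x.1.2, x.2))) _ _.
Next Obligation. by []. Qed.
Next Obligation. by []. Qed.

(* A simplex of arbitrary dimension. X n is a mere Type; {classic _} equips the
   sigma type with the choiceType structure that freemod asks for. *)
Definition simplex (X : sset) : Type := {classic {n & X n}}.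
HB.instance Definition _ X := Choice.on (simplex X).

Definition mksimplex (X : sset) n (x : X n) : simplex X := existT X n x.

Section Simplex.
Variable X : sset.
Implicit Type x : simplex X.

Definition dim x : nat := projT1 (x : {n & X n}).

(* sface and sdegen are only meaningful for i in range, i.e. i <= dim x, and
   0 < dim x for sface. *)
Definition sface (i : nat) x : simplex X :=
  match x with
  | existT n.+1 u => mksimplex (face (inord i) u)
  | _ => x
  end.

Definition sdegen (i : nat) x : simplex X :=
  let: existT n u := x in mksimplex (degen (inord i) u).

(* sfaces p q x = d_p d_(p+1) ... d_(q-1) x: the upper bound is exclusive, so
   the operator d_p^q (inclusive bounds) is sfaces p q.+1, and d_p^(p-1) = id is
   sfaces p p. *)
Definition sfaces (p q : nat) x : simplex X :=
  foldr sface x (iota p (q - p)).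

(* sdegens [:: a1; ...; ap] x = s_ap ... s_a1 x *)
Definition sdegens (a : seq nat) x : simplex X :=
  foldl (fun y i => sdegen i y) x a.

(* x is in the image of the degeneracy operator s_j. *)
Definition degenerate_at (j : nat) x : Prop :=
  exists2 y : simplex X, j <= dim y & x = sdegen j y.

Definition degenerate x : Prop := exists j, degenerate_at j x.

Lemma dim_sdegen i x : dim (sdegen i x) = (dim x).+1.
Proof. by case: x. Qed.

Lemma dim_sface i x : dim (sface i x) = (dim x).-1.
Proof. by case: x => [[|n] x]. Qed.

Lemma dim_sdegens a x : dim (sdegens a x) = size a + dim x.
Proof. by elim: a x => //= i a IH x; rewrite IH dim_sdegen addnS. Qed.

Lemma dim_sfaces p q x : dim (sfaces p q x) = dim x - (q - p).
Proof.
rewrite /sfaces; move: (q - p) => m.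
elim: m p => [|m IH] p /=; first by rewrite subn0.
by rewrite dim_sface IH subnS.
Qed.

Lemma sdegen_sdegen i j x : i <= j <= dim x ->
  sdegen i (sdegen j x) = sdegen j.+1 (sdegen i x).
Proof. by case: x => n x /= ij; rewrite /mksimplex degen_degen. Qed.

Lemma dg_sdegen_le i j x : degenerate_at i x -> j <= i ->
  degenerate_at i.+1 (sdegen j x).
Proof.
move=> [y iy ->] ji; exists (sdegen j y); first by rewrite dim_sdegen.
by rewrite sdegen_sdegen ?ji.
Qed.

Lemma dg_sdegen_gt i j x : degenerate_at i x -> i < j <= dim x ->
  degenerate_at i (sdegen j x).
Proof.
move=> [y iy ->]; case: j => // j; rewrite dim_sdegen !ltnS => ijy.
have /andP[ij jy] := ijy.
exists (sdegen j y); first by rewrite dim_sdegen leqW.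
by rewrite [RHS]sdegen_sdegen.
Qed.

Lemma dg_sface_lt i j x : degenerate_at j x -> i < j ->
  degenerate_at j.-1 (sface i x).
Proof.
move=> [[n y] /= jy ->] ij; case: n y jy => [|n] y jn.
  by move: (leq_trans ij jn).
exists (mksimplex (face (inord i) y)) => /=; first by case: j jn ij.
by rewrite /mksimplex face_degen_lt // ij.
Qed.

Lemma dg_sface_gt i j x : degenerate_at j x -> j.+1 < i <= dim x ->
  degenerate_at j (sface i x).
Proof.
move=> [[n y] /= jy ->] /=; case: n y jy => [|n] y jn.
  by move=> ij; exfalso; move: ij; rewrite /=; lia.
move=> ij; exists (mksimplex (face (inord i.-1) y)) => /=.
  by move: ij; rewrite /=; lia.
by rewrite /mksimplex face_degen_gt.
Qed.

Lemma dg_sfaces_lt m p x j : degenerate_at j x -> p <= j ->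
  degenerate_at (j - (p - m)) (sfaces m p x).
Proof.
rewrite /sfaces => jx pj; have [mp|pm] := leqP m p; last first.
  by rewrite (eqP (ltnW pm : p - m == 0)) subn0.
have : m + (p - m) <= j by rewrite subnKC.
move: (p - m) => d {mp pj}.
elim: d m => [|d IH] m mj /=; first by rewrite subn0.
by rewrite subnS; apply: dg_sface_lt; [apply: IH; lia | lia].
Qed.

Lemma dg_sfaces_gt m p x j : degenerate_at j x -> j.+1 < m ->
  p <= (dim x).+1 -> degenerate_at j (sfaces m p x).
Proof.
move=> jx jm px; have [mp|pm] := leqP m p; last first.
  by rewrite /sfaces (eqP (ltnW pm : p - m == 0)).
have {mp px} mp : m + (p - m) <= (dim x).+1 by rewrite subnKC.
rewrite /sfaces; move: (p - m) mp => d; elim: d m jm => [|d IH] m jm mp //=.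
apply: dg_sface_gt; first by apply: IH; lia.
rewrite jm /=; have := dim_sfaces m.+1 (m.+1 + d) x.
by rewrite /sfaces addKn => ->; lia.
Qed.

(* The increasing sequences a that occur as one half of a shuffle: they ensure
   that all the degeneracies in sdegens a x, dim x = d, are in range. *)
Definition admissible (a : seq nat) (d : nat) : bool :=
  sorted ltn a && all (gtn (size a + d)) a.

Lemma admissible_cons j a d : admissible (j :: a) d ->
  [/\ j <= d, all (ltn j) a & admissible a d.+1].
Proof.
rewrite /admissible /= => /andP[ja /andP[jd ad]]; split.
- elim: a j d ja jd ad => [|l a IH] j d /=; first by rewrite add1n ltnS.
  move=> /andP[jl la] _ /andP[ld ad].
  by have := IH l d.+1 la; rewrite !addnS => /(_ ld ad); lia.
- exact: order_path_min ltn_trans ja.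
- by rewrite (path_sorted ja) addnS.
Qed.

Lemma dg_sdegens_gt i a x : degenerate_at i x -> admissible a (dim x) ->
  all (ltn i) a -> degenerate_at i (sdegens a x).
Proof.
elim: a x => //= j a IH x ix /admissible_cons[jx ja ax] /andP[ij ia].
by apply: IH; rewrite ?dim_sdegen //; apply: dg_sdegen_gt; rewrite ?ij.
Qed.

Lemma dg_sdegens_mem i a x : admissible a (dim x) -> i \in a ->
  degenerate_at i (sdegens a x).
Proof.
elim: a x => //= j a IH x /admissible_cons[jx ja ax].
rewrite inE => /predU1P[->|ia]; last by apply: IH; rewrite ?dim_sdegen.
apply: dg_sdegens_gt; rewrite ?dim_sdegen //.
by exists x.
Qed.

Lemma dg_sdegens_notin i a x : degenerate_at i x -> admissible a (dim x) ->
  exists j, [/\ j \notin a, i <= j <= i + size a &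
               degenerate_at j (sdegens a x)].
Proof.
elim: a i x => [|l a IH] i x ix; first by exists i; rewrite addn0 leqnn.
move=> adm; have [lx la ax] := admissible_cons adm.
have [il|li] := ltnP i l.
  have ia : all (ltn i) (l :: a).
    by rewrite /= il; apply: sub_all la => b; exact: ltn_trans.
  exists i; split; [|by rewrite leqnn leq_addr|exact: dg_sdegens_gt].
  by apply/negP => /(allP ia) /=; rewrite ltnn.
have [||j [ja ij jx]] := IH i.+1 (sdegen l x).
- exact: dg_sdegen_le.
- by rewrite dim_sdegen.
exists j; split=> //=; last by move: ij => /=; lia.
by rewrite inE negb_or ja andbT; lia.
Qed.

Lemma dg_sdegens_ge i a x d : degenerate_at i x -> admissible a d ->
  d <= i -> degenerate_at (i + size a) (sdegens a x).
Proof.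
elim: a i x d => [|l a IH] i x d ix; first by rewrite addn0.
move=> /admissible_cons[ld la ad] di; rewrite /= addnS -addSn.
by apply: IH ad _ => //; apply: dg_sdegen_le => //; apply: leq_trans di.
Qed.

End Simplex.

Section Shuffle.
Variable m : nat.
Implicit Type A : {set 'I_m}.

(* enum lists a set of ordinals in increasing order. *)
Definition set_seq A : seq nat := [seq val i | i <- enum A].

Lemma size_set_seq A : size (set_seq A) = #|A|.
Proof. by rewrite size_map -cardE. Qed.

Lemma mem_set_seq A (i : 'I_m) : (val i \in set_seq A) = (i \in A).
Proof. by rewrite mem_map ?mem_enum //; exact: val_inj. Qed.

Lemma set_seq_lt A : all (gtn m) (set_seq A).
Proof. by apply/allP => _ /mapP[i _ ->] /=. Qed.

Lemma admissible_set A d : #|A| + d = m -> admissible (set_seq A) d.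
Proof.
move=> Am; rewrite /admissible size_set_seq Am set_seq_lt andbT.
rewrite /set_seq sorted_map; apply: sorted_filter.
  by move=> i j l /=; exact: ltn_trans.
by rewrite -sorted_map -enumT val_enum_ord iota_ltn_sorted.
Qed.

Fact shuffle_perm_subproof A :
  injective (fun i : 'I_m => nth i (enum A ++ enum (~: A)) i).
Proof.
have sz : size (enum A ++ enum (~: A)) = m.
  by rewrite size_cat -!cardE cardsC card_ord.
move=> i j; rewrite (set_nth_default i j) ?sz // => /eqP.
rewrite nth_uniq ?sz // => [/eqP/val_inj //|].
rewrite cat_uniq !enum_uniq andbT /=; apply/hasPn => x.
by rewrite !mem_enum inE.
Qed.

(* A shuffle (alpha, beta) of {0, ..., m-1} is given by A = alpha, beta being
   ~: A; this is the permutation with one-line notation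
   (alpha_1 < ... < alpha_p, beta_1 < ... < beta_q). *)
Definition shuffle_perm A : 'S_m := perm (@shuffle_perm_subproof A).
End Shuffle.

Local Close Scope nat_scope.

(* The graded k-module underlying the normalized chain complex: the direct sum
   over all n of k[X_n] modulo degenerate simplices. Since simplex X is the
   disjoint union of the X_n, the direct sum is the free module on simplex X,
   and tensor (chains k X) (chains k Y) is the direct sum of all the
   C_p(X) (x) C_q(Y). The differential plays no role here. *)
Section Chains.
Variables (k : comPzRingType) (X : sset).

Definition chains : Type :=
  quotmod [set freegen k x | x in [set x : simplex X | degenerate x]].
HB.instance Definition _ := GRing.Lmodule.on chains.

Definition cls (x : simplex X) : chains := qpi _ (freegen k x).

Lemma cls_degenerate x : degenerate x -> cls x = 0.
Proof.
move=> dx; rewrite /cls -[RHS](raddf0 (qpi _)).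
by apply/qpi_eq/asboolP/span_gen; exists x; rewrite ?subr0.
Qed.

Lemma chains_ind (P : chains -> Prop) : (forall x, P (cls x)) -> P 0 ->
  (forall a c d, P c -> P d -> P (a *: c + d)) -> forall c, P c.
Proof.
move=> Pg P0 PL c; rewrite -[c]qreprK -[qrepr c]freelift_genK.
rewrite /freelift linear_sum /=; elim/big_rec: _ => // x d _ Pd.
rewrite (_ : qpi _ _ = (qrepr c x : k) *: cls x); first exact: PL.
exact: qpi_scalable.
Qed.

Section Lift.
Variables (M : lmodType k) (f : simplex X -> M).
Hypothesis f0 : forall x, degenerate x -> f x = 0.

Fact chain_lift_subproof : forall c,
  c \in lspan [set freegen k x | x in [set x : simplex X | degenerate x]] ->
  freelift f c = 0.
Proof.
by apply: span_ker => _ [x /= dx <-]; rewrite freelift_gen f0.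
Qed.

Definition chain_lift : chains -> M := qlift chain_lift_subproof.
HB.instance Definition _ := GRing.Linear.on chain_lift.

Lemma chain_liftE x : chain_lift (cls x) = f x.
Proof. by rewrite /chain_lift /cls qlift_pi /= freelift_gen. Qed.
End Lift.

(* gsign d multiplies a chain of degree n by (-1)^(d n). *)
Fact gsign_subproof d x : degenerate x -> (-1) ^+ (d * dim x) *: cls x = 0.
Proof. by move=> /cls_degenerate ->; rewrite scaler0. Qed.

Definition gsign (d : nat) : chains -> chains := chain_lift (gsign_subproof d).
HB.instance Definition _ d := GRing.Linear.on (gsign d).
End Chains.
Arguments cls k {X}.

Section ChainMap.
Variables (k : comPzRingType) (X Y : sset) (f : smap X Y).

Definition smap_simplex (x : simplex X) : simplex Y :=
  let: existT n u := x in mksimplex (f n u).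

Fact chain_map_subproof x : degenerate x -> cls k (smap_simplex x) = 0.
Proof.
case=> j [[n y] /= jn ->]; apply: cls_degenerate.
by exists j, (smap_simplex (mksimplex y)); rewrite //= smap_degen.
Qed.

Definition chain_map : chains k X -> chains k Y :=
  chain_lift chain_map_subproof.
HB.instance Definition _ := GRing.Linear.on chain_map.
End ChainMap.

(* f (x) g for g homogeneous of degree dg, with the Koszul sign:
   (f (x) g)(x (x) y) = (-1)^(dg |x|) f x (x) g y. *)
Definition koszul_tensor (k : comPzRingType) (X Y X' Y' : sset)
    (f : {linear chains k X -> chains k X'}) (dg : nat)
    (g : {linear chains k Y -> chains k Y'}) :
  tensor (chains k X) (chains k Y) -> tensor (chains k X') (chains k Y') :=
  tmap (f \o gsign dg) g.
HB.instance Definition _ k X Y X' Y' f dg g :=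
  GRing.Linear.on (@koszul_tensor k X Y X' Y' f dg g).

Section Pairing.
Variables (k : comPzRingType) (X Y : sset).

(* The simplex (x, y) of X * Y as a chain, for x and y of the same dimension.
   The value 0 for different dimensions is never used: see dim_nabla_basis and
   dim_Htilde_basis. *)
Definition spair (x : simplex X) (y : simplex Y) : chains k (X \xs Y) :=
  let: existT m u := x in let: existT n v := y in
  match @eqP nat m n with
  | ReflectT e => cls k (@mksimplex (X \xs Y) n (ecast i (X i) e u, v))
  | ReflectF _ => 0
  end.

Lemma spairE n (u : X n) (v : Y n) :
  spair (mksimplex u) (mksimplex v) = cls k (@mksimplex (X \xs Y) n (u, v)).
Proof. by rewrite /spair /=; case: eqP => // e; rewrite eq_axiomK. Qed.

Lemma spair_neq x y : dim x != dim y -> spair x y = 0.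
Proof. by case: x y => [m u] [n v] /=; case: eqP. Qed.

Lemma spair_degenerate i x y : degenerate_at i x -> degenerate_at i y ->
  spair x y = 0.
Proof.
move=> [[m u] im ->] [[n v] jn ->].
have [e|ne] := eqVneq m n; last by apply: spair_neq; rewrite !dim_sdegen eqSS.
case: n / e v jn => v _.
rewrite [LHS](spairE (degen (inord i) u) (degen (inord i) v)).
by apply: cls_degenerate; exists i, (@mksimplex (X \xs Y) m (u, v)).
Qed.
End Pairing.

Section Nabla.
Variables (k : comPzRingType) (X Y : sset).

Definition nabla_basis (x : simplex X) (y : simplex Y) : chains k (X \xs Y) :=
  \sum_(A : {set 'I_(dim x + dim y)} | (#|A| == dim x)%N)
    (-1) ^+ shuffle_perm A *:
    spair k (sdegens (set_seq (~: A)) x) (sdegens (set_seq A) y).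

Lemma cardC_eq p q (A : {set 'I_(p + q)}) : (#|A| == p -> #|~: A| = q)%N.
Proof. by move=> /eqP Ap; have := cardsC A; rewrite Ap card_ord; lia. Qed.

Lemma dim_nabla_basis (x : simplex X) (y : simplex Y)
    (A : {set 'I_(dim x + dim y)}) : (#|A| == dim x)%N ->
  dim (sdegens (set_seq (~: A)) x) = (dim x + dim y)%N /\
  dim (sdegens (set_seq A) y) = (dim x + dim y)%N.
Proof.
move=> Ap; have Aq := cardC_eq Ap.
by rewrite !dim_sdegens !size_set_seq Aq (eqP Ap) addnC.
Qed.

Lemma set_seqC m (A : {set 'I_m}) j : (j < m)%N ->
  j \notin set_seq A -> j \in set_seq (~: A).
Proof.
move=> jm; rewrite -[j]/(val (Ordinal jm)) !mem_set_seq.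
by rewrite inE.
Qed.

Fact nabla_degenerate_r x y : degenerate y -> nabla_basis x y = 0.
Proof.
move=> [i dy]; rewrite /nabla_basis big1 // => A Ap.
have Aq := cardC_eq Ap; move/eqP: Ap => Ap.
have admA : admissible (set_seq A) (dim y) by apply: admissible_set; rewrite Ap.
have admC : admissible (set_seq (~: A)) (dim x).
  by apply: admissible_set; rewrite Aq addnC.
have [j [jA ij jy]] := dg_sdegens_notin dy admA.
rewrite (spair_degenerate k (i := j)) ?scaler0 //; apply: dg_sdegens_mem => //.
apply: set_seqC => //; case: jy => z jz /(congr1 (@dim Y)).
by rewrite dim_sdegens dim_sdegen size_set_seq Ap => ->.
Qed.

Fact nabla_degenerate_l x y : degenerate x -> nabla_basis x y = 0.
Proof.
move=> [i dx]; rewrite /nabla_basis big1 // => A Ap.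
have Aq := cardC_eq Ap; move/eqP: Ap => Ap.
have admA : admissible (set_seq A) (dim y) by apply: admissible_set; rewrite Ap.
have admC : admissible (set_seq (~: A)) (dim x).
  by apply: admissible_set; rewrite Aq addnC.
have [j [jA ij jx]] := dg_sdegens_notin dx admC.
rewrite (spair_degenerate k (i := j)) ?scaler0 //; apply: dg_sdegens_mem => //.
rewrite -[A]finset.setCK; apply: set_seqC => //.
case: jx => z jz /(congr1 (@dim X)).
by rewrite dim_sdegens dim_sdegen size_set_seq Aq addnC => ->.
Qed.

Definition nabla_simplex x : chains k Y -> chains k (X \xs Y) :=
  chain_lift (@nabla_degenerate_r x).
HB.instance Definition _ x := GRing.Linear.on (nabla_simplex x).

Fact nabla_simplex_degenerate d x : degenerate x -> nabla_simplex x d = 0.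
Proof.
move=> dx; elim/chains_ind: d => [y||a c d cE dE]; last first.
- by rewrite linearP /= cE dE scaler0 addr0.
- exact: linear0.
by rewrite /nabla_simplex chain_liftE nabla_degenerate_l.
Qed.

Definition nabla_bilin (c : chains k X) (d : chains k Y) :
  chains k (X \xs Y) := chain_lift (nabla_simplex_degenerate d) c.

Fact nabla_bilin_l d : linear (nabla_bilin^~ d).
Proof. exact: linearP. Qed.

Fact nabla_bilin_r c : linear (nabla_bilin c).
Proof.
move=> a d d'; elim/chains_ind: c => [x||b c c' IH IH'].
- by rewrite /nabla_bilin !chain_liftE linearP.
- by rewrite /nabla_bilin !linear0 addr0.
rewrite !nabla_bilin_l IH IH' !scalerDr !scalerA (mulrC b) -!addrA.
by congr (_ + _); rewrite addrCA.
Qed.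

Definition nabla : tensor (chains k X) (chains k Y) -> chains k (X \xs Y) :=
  tensor_lift nabla_bilin_l nabla_bilin_r.
HB.instance Definition _ := GRing.Linear.on nabla.

Lemma nablaE x y : nabla (tens (cls k x) (cls k y)) = nabla_basis x y.
Proof.
by rewrite /nabla tensor_liftE /nabla_bilin chain_liftE /nabla_simplex
  chain_liftE.
Qed.
End Nabla.

Section Htilde.
Variables (k : comPzRingType) (X Y : sset).

Definition sfst (z : simplex (X \xs Y)) : simplex X :=
  let: existT n u := z in mksimplex u.1.
Definition ssnd (z : simplex (X \xs Y)) : simplex Y :=
  let: existT n u := z in mksimplex u.2.

Definition Htilde_basis (z : simplex (X \xs Y)) : chains k (X \xs Y) :=
  let x := sfst z in let y := ssnd z in
  \sum_(p < dim z) \sum_(q < dim z | (p + q < dim z)%N)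
    \sum_(A : {set 'I_(p + q.+1)} | (#|A| == p)%N)
      (-1) ^+ (p + q + shuffle_perm A)%N *:
      spair k (sdegens (set_seq (~: A)) (sfaces p.+1 (p + q).+1 x))
              (sdegen (p + q).+1 (sdegens (set_seq A) (sfaces 0 p y))).

Lemma dim_Htilde_basis (z : simplex (X \xs Y)) (p q : nat)
    (A : {set 'I_(p + q.+1)}) : (p + q < dim z)%N -> (#|A| == p)%N ->
  dim (sdegens (set_seq (~: A)) (sfaces p.+1 (p + q).+1 (sfst z)))
    = (dim z).+1%N /\
  dim (sdegen (p + q).+1 (sdegens (set_seq A) (sfaces 0 p (ssnd z))))
    = (dim z).+1%N.
Proof.
case: z => n u /= pq Ap; have Aq := cardC_eq Ap.
rewrite dim_sdegen !dim_sdegens !dim_sfaces !size_set_seq Aq (eqP Ap) /=.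
by split; lia.
Qed.

Fact Htilde_degenerate z : degenerate z -> Htilde_basis z = 0.
Proof.
move=> [i [[n w] /= iw zE]].
have nz : dim z = n.+1%N by rewrite zE.
have nx : dim (sfst z) = n.+1%N by rewrite zE.
have ny : dim (ssnd z) = n.+1%N by rewrite zE.
have dx : degenerate_at i (sfst z).
  by rewrite zE; exists (mksimplex w.1).
have dy : degenerate_at i (ssnd z).
  by rewrite zE; exists (mksimplex w.2).
rewrite /Htilde_basis; apply: big1 => p _; apply: big1 => q pq.
apply: big1 => A Ap; have Aq := cardC_eq Ap; move/eqP: Ap => Ap.
set x := sfaces p.+1%N _ _; set y := sfaces 0 p _.
have dimx : dim x = (n.+1 - q)%N by rewrite dim_sfaces nx subSS addKn.
have dimy : dim y = (n.+1 - p)%N by rewrite dim_sfaces ny subn0.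
have adm d B e : admissible B d -> (d <= e)%N -> admissible B e.
  move=> /andP[sB aB] de; rewrite /admissible sB.
  by apply: sub_all aB => b /=; lia.
have admA : admissible (set_seq A) q.+1%N by apply: admissible_set; rewrite Ap.
have admC : admissible (set_seq (~: A)) p.
  by apply: admissible_set; rewrite Aq addnC.
have {}pq : (p + q < n.+1)%N by rewrite -nz.
have admx : admissible (set_seq (~: A)) (dim x) by apply: adm admC _; lia.
have admy : admissible (set_seq A) (dim y) by apply: adm admA _; lia.
have szA : size (set_seq A) = p by rewrite size_set_seq.
have szC : size (set_seq (~: A)) = q.+1%N by rewrite size_set_seq.
suff [j djx djy] : exists2 j, degenerate_at j (sdegens (set_seq (~: A)) x) &
    degenerate_at j (sdegen (p + q).+1%N (sdegens (set_seq A) y)).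
  by rewrite (spair_degenerate k djx djy) scaler0.
have bound : ((p + q).+1 <= dim (sdegens (set_seq A) y))%N.
  by rewrite dim_sdegens szA dimy; lia.
have [ip|pi] := ltnP i p.
  have {}dx : degenerate_at i x by apply: dg_sfaces_gt => //; rewrite nx; lia.
  have [j [jC ij djx]] := dg_sdegens_notin dx admx; exists j => //.
  have jpq : (j < p + q.+1)%N by lia.
  apply: dg_sdegen_gt; last by rewrite bound andbT; lia.
  apply: dg_sdegens_mem => //; rewrite -[A]finset.setCK; exact: set_seqC.
have {}dy : degenerate_at (i - p) y.
  by rewrite -[X in (i - X)%N]subn0; apply: dg_sfaces_lt.
have [ipq|pqi] := leqP i (p + q).
  have [j [jA ij djy]] := dg_sdegens_notin dy admy; exists j.
    by apply: dg_sdegens_mem => //; apply: set_seqC => //; lia.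
  by apply: dg_sdegen_gt => //; rewrite bound andbT; lia.
have {}dx : degenerate_at (i - q) x.
  rewrite (_ : i - q = i - ((p + q).+1 - p.+1))%N; last by lia.
  exact: dg_sfaces_lt.
exists i.+1%N.
  rewrite (_ : i.+1 = i - q + size (set_seq (~: A)))%N; last first.
    by rewrite szC; lia.
  by apply: dg_sdegens_ge admC _ => //; lia.
apply: dg_sdegen_le => //.
rewrite {1}(_ : i = i - p + size (set_seq A))%N; last by rewrite szA; lia.
by apply: dg_sdegens_ge admA _ => //; lia.
Qed.

Definition Htilde : chains k (X \xs Y) -> chains k (X \xs Y) :=
  chain_lift Htilde_degenerate.
HB.instance Definition _ := GRing.Linear.on Htilde.

Lemma HtildeE z : Htilde (cls k z) = Htilde_basis z.
Proof. exact: chain_liftE. Qed.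
End Htilde.

Arguments nabla k X Y : clear implicits.
Arguments Htilde k X Y : clear implicits.

(* Main.v *)
From mathcomp Require Import all_boot all_order all_algebra all_fingroup.
From mathcomp Require Import boolp.
From mathcomp Require Import zify.
Require Import Defs.

(** Every term on either side is a triple of simplices obtained by pulling x, y
    and z back along monotone maps with a common source, and hence a path each
    of whose steps moves some of the three factors. It vanishes as soon as one
    step moves none of them. A term of the shuffle map is a path in which each
    step moves either the first or the second factor by one. A term of the
    homotopy starts with p steps of the first factor and q + 1 steps of the
    second, in any order, the second factor starting p vertices ahead; then the
    first factor alone jumps from p to p + q + 1, which brings the two level,
    and after that both move together.

    In the first identity the left-hand side runs a path of the homotopy along a
    shuffle of x with (y, z). There the second factor is z, so one of its q + 1
    steps moves nothing if the shuffle advances x at that place. In the terms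
    that survive, each step before the jump moves exactly one of x, y, z, and
    each step after the jump moves x alone or y and z together. Such a term is
    thus a word t in the letters X, Y, Z with at least one Z, followed by a
    binary word v. The right-hand side inserts the steps of x into a path of the
    homotopy for (y, z), and so runs over the same pairs (t, v). In the second
    identity the first factor of the homotopy is x, so a surviving term has no
    steps of z among the p that the shuffle takes first; the jump must move x,
    which forces at least one Y, and the steps after the jump move z alone or x
    and y together. Decoding either kind of index into (t, v) and back gives the
    bijections fed to [big_bij] in [first_sum_identity] and
    [second_sum_identity].

    The pullbacks are compared through [act], which records a monotone map by
    its list of increments: a face operator adds two neighbouring entries
    ([sface_act_merge]) and a degeneracy inserts a zero ([sdegen_act_insert]),
    so that both composites can be read off. For the signs, a shuffle
    contributes the number of its inversions ([odd_shuffle_perm]). Within t both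
    sides count the pairs of letters that are out of order ([inv_letters]). In
    the first identity the jump of the right-hand side also lies before the
    steps of x in v, whose number, together with the Koszul sign and the
    difference between the two values of p, is even; in the second the two
    counts agree on the nose. *)

Set Implicit Arguments.
Unset Strict Implicit.
Unset Printing Implicit Defensive.

Import GRing.Theory.
Local Open Scope nat_scope.

(** * Simplicial operators as lists of increments *)

Section Identities.
Variable X : sset.
Implicit Types (x y : simplex X).

Lemma sface_sface i j x : i < j <= dim x -> 1 < dim x ->
  sface i (sface j x) = sface j.-1 (sface i x).
Proof.
by case: x => [[|[|n]] x] //= ij _; rewrite /mksimplex face_face.
Qed.

Lemma sface_sdegen_lt i j x : i < j <= dim x ->
  sface i (sdegen j x) = sdegen j.-1 (sface i x).
Proof.
case: x => [[|n] x] /= ij; first by exfalso; lia.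
by rewrite /mksimplex face_degen_lt.
Qed.

Lemma sface_sdegen_id j x : j <= dim x -> sface j (sdegen j x) = x.
Proof. by case: x => [n x] /= jn; rewrite /mksimplex face_degen_id. Qed.

Lemma sface_sdegen_succ j x : j <= dim x -> sface j.+1 (sdegen j x) = x.
Proof. by case: x => [n x] /= jn; rewrite /mksimplex face_degen_succ. Qed.

Lemma sface_sdegen_gt i j x : j.+1 < i <= (dim x).+1 ->
  sface i (sdegen j x) = sdegen j (sface i.-1 x).
Proof.
case: x => [[|n] x] /= ij; first by exfalso; lia.
by rewrite /mksimplex face_degen_gt.
Qed.

(** The operator by which vertex i of the pullback comes to lie c vertices after
    vertex i - 1, given that they are consecutive in y. For i = 0 the
    predecessor is a fictitious vertex -1. *)
Definition step i c y :=
  if c is c'.+1 then iter c' (sface i) y else sdegen i.-1 y.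

(** The pullback of y along the monotone map with increments cs from vertex i
    on. With i = 0 the head of cs is one more than the image of vertex 0, and
    the increments beyond the end of cs are all 1, that is, the map just continues
    to the last vertex of y. *)
Fixpoint act i (cs : seq nat) y :=
  if cs is c :: cs' then act i.+1 cs' (step i c y) else y.

(** The increments cs stay within a simplex of dimension d. *)
Definition valid i cs d :=
  (i + sumn cs <= d.+1) && ((0 < i) || (0 < head 1 cs)).

Lemma dim_iter_sface c i y : dim (iter c (sface i) y) = dim y - c.
Proof. by elim: c => [|c IH] /=; rewrite ?subn0 // dim_sface IH; lia. Qed.

Lemma dim_step i c cs y : valid i (c :: cs) (dim y) ->
  dim (step i c y) + c = (dim y).+1.
Proof.
case: c => [|c] /andP[/= h _]; first by rewrite dim_sdegen addn0.
by rewrite dim_iter_sface; lia.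
Qed.

Lemma valid_step i c cs y :
  valid i (c :: cs) (dim y) -> valid i.+1 cs (dim (step i c y)).
Proof.
by move=> w; have := dim_step w; case/andP: w => /= h _; rewrite /valid; lia.
Qed.

Lemma dim_act i cs y : valid i cs (dim y) ->
  dim (act i cs y) + sumn cs = dim y + size cs.
Proof.
elim: cs i y => [|c cs IH] i y //= w.
by have := IH _ _ (valid_step w); have := dim_step w; lia.
Qed.

Lemma iter_sface_gt i j c y : i < j -> j + c <= dim y ->
  sface i (iter c (sface j.+1) y) = iter c (sface j) (sface i y).
Proof.
move=> ij; elim: c => //= c IH h; rewrite sface_sface ?dim_iter_sface; try lia.
by rewrite IH //; lia.
Qed.

Lemma sface_step i j c y : i < j -> j + c <= dim y ->
  sface i (step j.+1 c y) = step j c (sface i y).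
Proof.
case: c => [|c] ij h /=; first by rewrite sface_sdegen_lt //; lia.
by apply: iter_sface_gt => //; lia.
Qed.

(** Faces and degeneracies below position j slide through the operators that
    [act] applies from there on, because these act on higher vertices. *)
Lemma sface_act i j cs y : i < j -> j + sumn cs <= dim y ->
  sface i (act j.+1 cs y) = act j cs (sface i y).
Proof.
elim: cs j y => //= c cs IH j y ij h.
have d : dim (step j.+1 c y) + c = (dim y).+1.
  by apply: (@dim_step _ _ cs); rewrite /valid /=; lia.
rewrite IH; try lia.
by rewrite sface_step //; lia.
Qed.

Lemma sdegen_step i j c y : i < j -> j + c <= (dim y).+1 ->
  sdegen i (step j c y) = step j.+1 c (sdegen i y).
Proof.
case: c => [|c] ij h /=; first by rewrite sdegen_sdegen ?prednK //; lia.
elim: c h => //= c IH h; rewrite -IH; last by lia.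
by rewrite sface_sdegen_gt //= dim_iter_sface; lia.
Qed.

Lemma sdegen_act_lt i j cs y : i < j -> j + sumn cs <= (dim y).+1 ->
  sdegen i (act j cs y) = act j.+1 cs (sdegen i y).
Proof.
elim: cs j y => //= c cs IH j y ij h.
have d : dim (step j c y) + c = (dim y).+1.
  by apply: (@dim_step _ _ cs); rewrite /valid /=; lia.
rewrite IH; try lia.
by rewrite sdegen_step //; lia.
Qed.

Lemma iter_sface_succ i c y : i + c < dim y ->
  sface i (iter c (sface i.+1) y) = iter c.+1 (sface i) y.
Proof.
elim: c => //= c IH h; rewrite sface_sface ?dim_iter_sface; try lia.
by rewrite IH //; lia.
Qed.

Lemma sface_step_step i a b y :
  i + (a + b) <= (dim y).+1 -> (0 < i) || (0 < a) ->
  sface i (step i.+1 b (step i a y)) = step i (a + b) y.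
Proof.
move=> h ia; have d : dim (step i a y) + a = (dim y).+1.
  by apply: (@dim_step _ _ [:: b]); rewrite /valid /=; lia.
case: b h => [|b] h.
  by rewrite addn0 [X in sface _ X]/= sface_sdegen_id //; lia.
rewrite [step i.+1 _ _]/= iter_sface_succ; last by lia.
rewrite addnS [RHS]/=; case: a h ia {d} => [|a] h ia; last first.
  by rewrite [X in iter b.+1 _ X]/= -iterD addSnnS addnC.
rewrite [X in iter b.+1 _ X]/= iterSr; congr (iter b (sface i) _).
by case: i h ia => //= i h _; rewrite sface_sdegen_succ //; lia.
Qed.

(** Dropping a vertex adds the increments on its two sides. *)
Lemma sface_act_merge i pre a b post y :
  valid i (pre ++ a :: b :: post) (dim y) ->
  sface (i + size pre) (act i (pre ++ a :: b :: post) y) =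
  act i (pre ++ (a + b) :: post) y.
Proof.
elim: pre i y => [|c pre IH] i y w.
  have d := dim_step w; have d' := dim_step (valid_step w).
  case/andP: w => /= h ia; rewrite addn0 sface_act; try lia.
  by rewrite sface_step_step //; lia.
by rewrite /= addnS -addSn IH //; apply: valid_step.
Qed.

(** Repeating a vertex inserts an increment 0 after it. *)
Lemma sdegen_act_insert i pre a post y : valid i (pre ++ a :: post) (dim y) ->
  sdegen (i + size pre) (act i (pre ++ a :: post) y) =
  act i (pre ++ a :: 0 :: post) y.
Proof.
elim: pre i y => [|c pre IH] i y w.
  have d := dim_step w; case/andP: w => /= h ia; rewrite addn0 sdegen_act_lt //.
  by lia.
by rewrite /= addnS -addSn IH //; apply: valid_step.
Qed.

Lemma act_nseq1 i c y : act i (nseq c 1) y = y.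
Proof. by elim: c i => //= c IH i; rewrite IH. Qed.

End Identities.

Lemma valid0_cons a cs d :
  valid 0 (a :: cs) d = (0 < a) && (a + sumn cs <= d.+1).
Proof. by rewrite /valid andbC. Qed.

Lemma sumn_cons a cs : sumn (a :: cs) = a + sumn cs.
Proof. by []. Qed.

(** Reduces validity of a list to a linear inequality between partial sums. *)
Definition sumE := (valid0_cons, sumn_cat, sumn_cons, add0n).

Lemma count_negb w : count id w + count negb w = size w.
Proof. exact: count_predC. Qed.

(** The increments of a path that consumes an entry of cs at each letter true of
    w and stands still at each letter false. Reading 1 off an exhausted cs makes
    it agree with the convention on increments beyond the end of a list. *)
Fixpoint weave (w : bitseq) (cs : seq nat) : seq nat :=
  match w with
  | [::] => [::]
  | true :: w' => head 1 cs :: weave w' (behead cs)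
  | false :: w' => 0 :: weave w' cs
  end.

Lemma size_weave w cs : size (weave w cs) = size w.
Proof. by elim: w cs => [|[] w IH] cs //=; rewrite IH. Qed.

Lemma weave_cat w w' cs cs' : size cs = count id w ->
  weave (w ++ w') (cs ++ cs') = weave w cs ++ weave w' cs'.
Proof.
elim: w cs => [|[] w IH] cs /=; first by move/size0nil->.
  by case: cs => //= c cs [/IH ->].
by move/IH->.
Qed.

Lemma weave_nseq1 w k : weave w (nseq k 1) = map nat_of_bool w.
Proof.
elim: w k => [|[] w IH] k //=; last by rewrite IH.
case: k => [|k] /=; last by rewrite IH.
by rewrite -[[::]]/(nseq 0 1) IH.
Qed.

Lemma sumn_weave w cs : size cs = count id w -> sumn (weave w cs) = sumn cs.
Proof.
elim: w cs => [|[] w IH] cs /=; first by move/size0nil->.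
  by case: cs => //= c cs [/IH ->].
by move/IH->.
Qed.

Section Operators.
Variable X : sset.
Implicit Types (x y : simplex X) (w : bitseq).

(** The path that stands still at the letters false of w: with w the word of
    alpha in a shuffle (alpha, beta), this is s_beta, and its value at the
    negated word is s_alpha. *)
Definition stretch w x : simplex X :=
  sdegens (mask (map negb w) (iota 0 (size w))) x.

(** The two components of a term of the homotopy. The pair (p, q) is not kept
    apart from the shuffle: w is the word of alpha, p is its number of letters
    true and q + 1 its number of letters false. *)
Definition Hfst w x : simplex X :=
  stretch w (sfaces (count id w).+1 (size w) x).

Definition Hsnd w x : simplex X :=
  sdegen (size w) (stretch (map negb w) (sfaces 0 (count id w) x)).

Lemma sdegen_act a cs post x : valid 0 (a :: cs ++ post) (dim x) ->
  sdegen (size cs) (act 0 (a :: cs ++ post) x) = act 0 (a :: cs ++ 0 :: post) x.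
Proof.
rewrite -!cat_cons lastI !cat_rcons => w0; rewrite -sdegen_act_insert //.
by rewrite size_belast.
Qed.

Lemma sdegens_weave a pre w c post x :
  valid 0 (a :: pre ++ c ++ post) (dim x) -> size c = count id w ->
  sdegens (mask (map negb w) (iota (size pre) (size w)))
    (act 0 (a :: pre ++ c ++ post) x) = act 0 (a :: pre ++ weave w c ++ post) x.
Proof.
elim: w pre c => [|[] w IH] pre c w0 /=.
- by move=> /size0nil ->.
- case: c w0 => //= b c w0 [szc].
  have := IH (rcons pre b) c; rewrite size_rcons !cat_rcons; exact.
move=> szc; rewrite sdegen_act //.
have := IH (rcons pre 0) c; rewrite size_rcons !cat_rcons; apply=> //.
by move: w0; rewrite !sumE.
Qed.

Lemma stretch_act a w c post x : valid 0 (a :: c ++ post) (dim x) ->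
  size c = count id w ->
  stretch w (act 0 (a :: c ++ post) x) = act 0 (a :: weave w c ++ post) x.
Proof. exact: (@sdegens_weave a [::]). Qed.

Lemma sfaces_act pre c post x : 0 < size c ->
  valid 0 (pre ++ c ++ post) (dim x) ->
  sfaces (size pre) (size pre + (size c).-1) (act 0 (pre ++ c ++ post) x) =
  act 0 (pre ++ sumn c :: post) x.
Proof.
case: c => //= a c _; rewrite /sfaces addKn.
elim: c pre a => [|b c IH] pre a w0 /=; first by rewrite addn0.
have := IH (rcons pre a) b; rewrite cat_rcons size_rcons => -> //.
rewrite cat_rcons -sface_act_merge ?add0n //.
by move: w0; case: (pre) => [|? ?]; rewrite ?cat0s ?cat_cons !sumE; lia.
Qed.

Lemma Hfst_act w c1 c2 c3 x : valid 0 (1 :: c1 ++ c2 ++ c3) (dim x) ->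
  size c1 = count id w -> size c2 = count negb w -> 0 < size c2 ->
  Hfst w (act 0 (1 :: c1 ++ c2 ++ c3) x) =
  act 0 (1 :: weave w c1 ++ sumn c2 :: c3) x.
Proof.
move=> w0 s1 s2 s20; have szw := count_negb w.
rewrite /Hfst -stretch_act //; last first.
  by move: w0; rewrite !sumE; lia.
have := @sfaces_act (1 :: c1) c2 c3 x s20 w0.
rewrite [size (_ :: _)]/= s1 /= => <-.
congr (stretch _ (sfaces _ _ _)); lia.
Qed.

Lemma Hsnd_act w c1 c2 c3 x : valid 0 (1 :: c1 ++ c2 ++ c3) (dim x) ->
  size c1 = count id w -> size c2 = count negb w ->
  Hsnd w (act 0 (1 :: c1 ++ c2 ++ c3) x) =
  act 0 ((sumn c1).+1 :: weave (map negb w) c2 ++ 0 :: c3) x.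
Proof.
move=> w0 s1 s2.
have sf : sfaces 0 (count id w) (act 0 (1 :: c1 ++ c2 ++ c3) x) =
          act 0 ((sumn c1).+1 :: c2 ++ c3) x.
  by rewrite -s1; apply: (@sfaces_act [::] (1 :: c1) (c2 ++ c3) x).
have w1 : valid 0 ((sumn c1).+1 :: c2 ++ c3) (dim x).
  by move: w0; rewrite !sumE; lia.
rewrite /Hsnd sf stretch_act //; last by rewrite s2 count_map; apply: eq_count.
rewrite -[X in sdegen X _](_ : size (weave (map negb w) c2) = _); last first.
  by rewrite size_weave size_map.
rewrite sdegen_act //; move: w1.
rewrite !sumE sumn_weave //.
by rewrite s2 count_map; apply: eq_count.
Qed.

(** An increment 0 into vertex j + 1 means that vertex j is repeated. *)
Lemma degenerate_act j cs x : valid 0 cs (dim x) -> j.+1 < size cs ->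
  nth 0 cs j.+1 = 0 -> degenerate_at j (act 0 cs x).
Proof.
move=> w0 js j0.
have Ecs : cs = take j cs ++ nth 0 cs j :: 0 :: drop j.+2 cs.
  by rewrite -j0 -!drop_nth ?cat_take_drop //; lia.
have w1 : valid 0 (take j cs ++ nth 0 cs j :: drop j.+2 cs) (dim x).
  move: w0; rewrite {1}Ecs; case: (take j cs) => [|? ?].
    by rewrite !cat0s !sumE; lia.
  by rewrite !cat_cons !sumE; lia.
exists (act 0 (take j cs ++ nth 0 cs j :: drop j.+2 cs) x).
  have := dim_act w1; rewrite size_cat /= size_takel ?size_drop; last by lia.
  by case/andP: w1; lia.
rewrite {1}Ecs -sdegen_act_insert //; congr (sdegen _ _).
by rewrite add0n size_takel //; lia.
Qed.

End Operators.

(** Applied below to the two projections of a product, so that the operators on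
    simplices of a product are computed factorwise. *)
Section Naturality.
Variables (X Y : sset) (f : simplex X -> simplex Y).
Hypotheses (f_sface : forall i x, f (sface i x) = sface i (f x))
  (f_sdegen : forall i x, f (sdegen i x) = sdegen i (f x)).

Lemma map_sdegens a x : f (sdegens a x) = sdegens a (f x).
Proof. by elim: a x => //= i a IH x; rewrite IH f_sdegen. Qed.

Lemma map_sfaces p q x : f (sfaces p q x) = sfaces p q (f x).
Proof.
by rewrite /sfaces; elim: (iota _ _) => //= i a IH; rewrite f_sface IH.
Qed.

Lemma map_stretch w x : f (stretch w x) = stretch w (f x).
Proof. exact: map_sdegens. Qed.

Lemma map_Hfst w x : f (Hfst w x) = Hfst w (f x).
Proof. by rewrite /Hfst map_stretch map_sfaces. Qed.

Lemma map_Hsnd w x : f (Hsnd w x) = Hsnd w (f x).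
Proof. by rewrite /Hsnd f_sdegen map_stretch map_sfaces. Qed.

End Naturality.

(** * Shuffles as binary words *)

Section Words.
Variable m : nat.
Implicit Types A : {set 'I_m}.

(** A shuffle (alpha, beta) becomes a binary word, true at the elements of
    alpha; unlike subsets of ordinals, words of different lengths can be cut and
    concatenated. *)
Definition word A : bitseq := [seq i \in A | i <- enum 'I_m].

Lemma size_word A : size (word A) = m.
Proof. by rewrite size_map size_enum_ord. Qed.

Lemma nth_word A (i : 'I_m) : nth false (word A) i = (i \in A).
Proof. by rewrite (nth_map i) ?size_enum_ord // nth_ord_enum. Qed.

Lemma word_inj : injective word.
Proof. by move=> A B AB; apply/setP => i; rewrite -!nth_word AB. Qed.

Lemma word_setC A : word (~: A) = map negb (word A).
Proof. by rewrite -map_comp; apply: eq_map => i /=; rewrite inE. Qed.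

Lemma set_seq_mask A : set_seq A = mask (word A) (iota 0 m).
Proof.
rewrite /set_seq -val_enum_ord -map_mask -filter_mask; congr (map _ _).
by rewrite {1}/enum_mem -enumT; apply: eq_filter.
Qed.

Lemma count_word A : count id (word A) = #|A|.
Proof.
by rewrite -size_set_seq set_seq_mask size_mask // size_word size_iota.
Qed.

Definition words := [seq word A | A : {set 'I_m}].

Lemma words_uniq : uniq words.
Proof. by rewrite map_inj_uniq ?enum_uniq //; apply: word_inj. Qed.

Lemma mem_words (w : bitseq) : (w \in words) = (size w == m).
Proof.
apply/imageP/eqP => [[A _ ->]|sw]; first exact: size_word.
exists [set i : 'I_m | nth false w i] => //.
apply: (@eq_from_nth _ false) => [|i iw]; first by rewrite size_word.
by rewrite sw in iw; rewrite (nth_word _ (Ordinal iw)) inE.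
Qed.

Lemma big_words (V : nmodType) (P : pred bitseq) (F : bitseq -> V) :
  (\sum_(A : {set 'I_m} | P (word A)) F (word A) =
   \sum_(w <- words | P w) F w)%R.
Proof. by rewrite big_image_cond. Qed.

End Words.

(** The inversions of the shuffle permutation: pairs of a letter false and a
    later letter true. *)
Fixpoint inv (w : bitseq) : nat :=
  if w is b :: w' then (if b then 0 else count id w') + inv w' else 0.

Lemma inv_cat w w' :
  inv (w ++ w') = inv w + inv w' + count negb w * count id w'.
Proof.
elim: w => [|b w IH] /=; first by rewrite addn0.
by rewrite IH count_cat; case: b => /=; lia.
Qed.

Lemma inv_nseq b n : inv (nseq n b) = 0.
Proof. by elim: n => //= n ->; case: b => //; rewrite count_nseq. Qed.

Lemma shuffle_permE m (A : {set 'I_m}) (i : 'I_m) :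
  shuffle_perm A i = nth 0 (mask (word A) (iota 0 m) ++
                            mask (map negb (word A)) (iota 0 m)) i :> nat.
Proof.
have sz : i < size (enum A ++ enum (~: A)).
  by rewrite size_cat -!cardE cardsC card_ord.
rewrite permE -word_setC -!set_seq_mask /set_seq -map_cat (nth_map i) //.
Qed.

(** Removing the letter 0 from the one-line notation of a shuffle removes the
    first letter of its word. The letter 0 sits in front if it belongs to alpha,
    and right after all of alpha otherwise. *)
Lemma shuffle_permS m (A : {set 'I_m.+1}) b w (p : 'I_m.+1) (A' : {set 'I_m}) :
  word A = b :: w -> word A' = w -> p = (if b then 0 else count id w) :> nat ->
  shuffle_perm A = lift_perm p ord0 (shuffle_perm A').
Proof.
move=> wA wA' pE; apply/permP => i; apply/val_inj => /=.
have szw : size w = m by rewrite -wA' size_word.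
have iotaS v : mask v (iota 1 m) = map S (mask v (iota 0 m)).
  by rewrite map_mask -(iotaDl 1).
pose s := mask w (iota 0 m) ++ mask (map negb w) (iota 0 m).
have szm : size (mask w (iota 0 m)) = count id w.
  by rewrite size_mask ?size_iota.
have szs : size s = m.
  rewrite size_cat szm size_mask ?size_map ?size_iota // count_map -[RHS]szw.
  by rewrite -(count_negb w).
rewrite shuffle_permE wA.
have -> : mask (b :: w) (iota 0 m.+1) ++
          mask (map negb (b :: w)) (iota 0 m.+1) =
          map S (take p s) ++ 0 :: map S (drop p s).
  rewrite /s; case: b {wA} pE => /= ->; rewrite !iotaS.
    by rewrite take0 drop0 map_cat.
  by rewrite -szm take_size_cat // drop_size_cat.
have szp : size (map S (take p s)) = p.
  by rewrite size_map size_takel // szs -ltnS.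
rewrite nth_cat szp; case: (unliftP p i) => [j ->|->]; last first.
  by rewrite lift_perm_id ltnn subnn.
rewrite lift_perm_lift lift0 shuffle_permE wA' -/s /=.
have [pj|jp] := leqP p j.
  rewrite (_ : bump p j = j.+1) /bump ?pj // ltnNge (leqW pj) subSn //=.
  by rewrite (nth_map 0) ?nth_drop ?subnKC // size_drop szs ltn_sub2rE.
have -> : bump p j = j by rewrite /bump leqNgt jp.
rewrite jp.
by rewrite (nth_map 0) ?nth_take // size_takel // szs -ltnS.
Qed.

(** Moving the letter 0 to the front takes as many transpositions as there are
    inversions involving it. *)
Lemma odd_shuffle_perm m (A : {set 'I_m}) :
  odd_perm (shuffle_perm A) = odd (inv (word A)).
Proof.
elim: m A => [|m IH] A.
  rewrite (_ : shuffle_perm A = 1%g) ?odd_perm1; last by apply/permP => -[].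
  by case: (word A) (size_word A).
have [b [w wA]] : exists b w, word A = b :: w.
  by case: (word A) (size_word A) => // b w; exists b, w.
have /imageP[A' _ wA'] : w \in words m.
  by rewrite mem_words -eqSS -[X in _ == X](size_word A) wA.
have pm : (if b then 0 else count id w) < m.+1.
  have := count_size id w; rewrite wA' size_word; case: (b) => //; lia.
rewrite (shuffle_permS wA (esym wA') (p := Ordinal pm)) // odd_lift_perm IH.
by rewrite -wA' wA /= oddD addbF.
Qed.

Definition shuf p q := [seq w <- words (p + q) | count id w == p].

Lemma mem_shuf p q (w : bitseq) :
  (w \in shuf p q) = (size w == p + q) && (count id w == p).
Proof. by rewrite mem_filter mem_words andbC. Qed.

Lemma shuf_uniq p q : uniq (shuf p q).
Proof. by rewrite filter_uniq ?words_uniq. Qed.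

(** The words that index the terms of the homotopy in dimension n, enumerated in
    the order of the double sum over p and q. *)
Definition Hwords n :=
  [seq w | pq <- [seq (p, q) | p <- iota 0 n, q <- iota 0 n],
           w <- if pq.1 + pq.2 < n then shuf pq.1 pq.2.+1 else [::]].

Lemma mem_Hwords n (w : bitseq) :
  (w \in Hwords n) = (size w <= n) && has negb w.
Proof.
apply/allpairsPdep/andP => [[[p q]] [v] [/= pq vw ->]|[sw]].
  case: ifP vw => // pqn; rewrite mem_shuf => /andP[/eqP /= sv /eqP /= cv].
  by rewrite has_count; have := count_negb v; lia.
rewrite has_count => cw; have cE := count_negb w.
exists (count id w, (count negb w).-1), w; split=> //.
  by apply: allpairs_f; rewrite mem_iota; lia.
rewrite ifT /=; last by lia.
by rewrite mem_shuf; lia.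
Qed.

Lemma Hwords_uniq n : uniq (Hwords n).
Proof.
apply: allpairs_uniq_dep => [|[p q] _|].
- by apply: allpairs_uniq; rewrite ?iota_uniq // => -[? ?] [? ?].
- by case: ifP => // _; apply: shuf_uniq.
move=> u v /allpairsPdep[[p q] [w [_ /= wpq ->]]].
move=> /allpairsPdep[[p' q'] [w' [_ /= wpq' ->]]] /= ww'.
rewrite -{}ww' in wpq' *; have cw := count_negb w.
case: ifP wpq => // _; case: ifP wpq' => // _; rewrite !mem_shuf.
move=> /andP[/eqP sw /eqP cp] /andP[/eqP sw' /eqP cp'].
by have [<- <-] : p' = p /\ q' = q by lia.
Qed.

(** Change of variables through a third index type K, of which D selects the
    relevant elements. The terms of the first sum outside the image of f are
    allowed, provided that they vanish. *)
Lemma big_bij (V : nmodType) (I J : eqType) (K : Type) (s : seq I) (t : seq J)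
    (D : K -> Prop) (f : K -> I) (g : K -> J) (f' : I -> K) (g' : J -> K)
    (F : I -> V) (G : J -> V) : uniq s -> uniq t ->
    (forall x, D x -> f x \in s /\ f' (f x) = x) ->
    (forall x, D x -> g x \in t /\ g' (g x) = x) ->
    (forall j, j \in t -> D (g' j) /\ g (g' j) = j) ->
    (forall i, i \in s -> F i = 0%R \/ D (f' i) /\ f (f' i) = i) ->
    (forall x, D x -> F (f x) = G (g x)) ->
  (\sum_(i <- s) F i = \sum_(j <- t) G j)%R.
Proof.
move=> us ut fs gt tD sD FG; pose h j := f (g' j).
transitivity (\sum_(i <- [seq h j | j <- t]) F i)%R; last first.
  rewrite big_map; apply: eq_big_seq => j jt; have [Dj gj] := tD j jt.
  by rewrite FG // gj.
rewrite (bigID (mem [seq h j | j <- t])) /=.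
rewrite [X in (_ + X)%R]big1_seq; last first.
  move=> i /andP[/negP ni si]; case: (sD i si) => // -[Di fi]; case: ni.
  have [gi gK] := gt _ Di.
  by apply/mapP; exists (g (f' i)) => //; rewrite /h gK fi.
rewrite addr0 -big_filter; apply/perm_big/uniq_perm.
- exact: filter_uniq.
- rewrite map_inj_in_uniq // => j j' jt j't hj.
  have [Dj gj] := tD j jt; have [Dj' gj'] := tD j' j't.
  have [_ fj] := fs _ Dj; have [_ fj'] := fs _ Dj'.
  by rewrite -gj -gj' -fj -fj' -/(h j) -/(h j') hj.
move=> i; rewrite mem_filter; case: mapP => //= -[j jt ->].
by have [Dj _] := tD j jt; have [-> _] := fs _ Dj.
Qed.

(** * Staircases on simplices *)

Local Notation nats := (map nat_of_bool).

Lemma sumn_nats w : sumn (nats w) = count id w.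
Proof. exact: sumn_count. Qed.

Lemma count_map_negb w : count id (map negb w) = count negb w.
Proof. by rewrite count_map; apply: eq_count. Qed.

Lemma count_negb_map w : count negb (map negb w) = count id w.
Proof. by rewrite count_map; apply: eq_count => b; rewrite /= negbK. Qed.

Lemma count_id_map (T : Type) (a : T -> bool) s :
  count id (map a s) = count a s.
Proof. by rewrite count_map; apply: eq_count. Qed.

Section Terms.
Variable X : sset.
Implicit Type x : simplex X.

Lemma stretch_nseq n x : stretch (nseq n true) x = x.
Proof. by rewrite /stretch map_nseq mask_false. Qed.

Lemma stretch_nats v x : count id v = dim x ->
  stretch v x = act 0 (1 :: nats v) x.
Proof.
move=> vx; have := @stretch_act X 1 v (nseq (dim x) 1) [::] x.
rewrite weave_nseq1 !cats0 -[1 :: nseq _ _]/(nseq (dim x).+1 1) act_nseq1.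
apply; rewrite ?size_nseq // !sumE sumn_nseq mul1n; exact: leqnn.
Qed.

(** The composites on the left-hand sides: a path of the homotopy run along a
    shuffle, cut into the part v1 used by the first factor before the jump, the
    part v2 used by the second, and the common rest v3. *)
Lemma Hfst_stretch w v1 v2 v3 x : count id (v1 ++ v2 ++ v3) = dim x ->
  size v1 = count id w -> size v2 = count negb w -> 0 < size v2 ->
  Hfst w (stretch (v1 ++ v2 ++ v3) x) =
  act 0 (1 :: weave w (nats v1) ++ count id v2 :: nats v3) x.
Proof.
move=> vx s1 s2 v20; rewrite stretch_nats // !map_cat Hfst_act ?size_map //.
  by rewrite sumn_nats.
rewrite !sumE !sumn_nats -!count_cat vx; exact: leqnn.
Qed.

Lemma Hsnd_stretch w v1 v2 v3 x : count id (v1 ++ v2 ++ v3) = dim x ->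
  size v1 = count id w -> size v2 = count negb w ->
  Hsnd w (stretch (v1 ++ v2 ++ v3) x) =
  act 0 ((count id v1).+1 :: weave (map negb w) (nats v2) ++ 0 :: nats v3) x.
Proof.
move=> vx s1 s2; rewrite stretch_nats // !map_cat Hsnd_act ?size_map //.
  by rewrite sumn_nats.
rewrite !sumE !sumn_nats -!count_cat vx; exact: leqnn.
Qed.

Lemma valid_Hfst w v1 v2 v3 x : count id (v1 ++ v2 ++ v3) = dim x ->
  size v1 = count id w ->
  valid 0 (1 :: weave w (nats v1) ++ count id v2 :: nats v3) (dim x).
Proof.
move=> vx s1; rewrite !sumE sumn_weave ?size_map // !sumn_nats.
by rewrite -vx !count_cat; lia.
Qed.

Lemma valid_Hsnd w v1 v2 v3 x : count id (v1 ++ v2 ++ v3) = dim x ->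
  size v2 = count negb w ->
  valid 0 ((count id v1).+1 :: weave (map negb w) (nats v2) ++ 0 :: nats v3)
    (dim x).
Proof.
move=> vx s2; rewrite !sumE sumn_weave ?size_map ?count_map_negb // !sumn_nats.
by rewrite -vx !count_cat; lia.
Qed.

Lemma nseq_true_split w n : size w <= n -> nseq n true =
  nseq (count id w) true ++ nseq (count negb w) true ++ nseq (n - size w) true.
Proof. by rewrite -!nseqD => wn; congr nseq; have := count_negb w; lia. Qed.

(** The homotopy terms alone, as the previous composites with a shuffle that
    never stands still. *)
Lemma Hfst_nats w x : size w <= dim x -> has negb w ->
  Hfst w x = act 0 (1 :: nats w ++ count negb w :: nseq (dim x - size w) 1) x.
Proof.
rewrite has_count => wx nw; rewrite -{1}(stretch_nseq (dim x) x).
have Ev := nseq_true_split wx; rewrite {1}Ev Hfst_stretch ?size_nseq //.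
  by rewrite !map_nseq weave_nseq1 count_nseq mul1n.
by rewrite -Ev count_nseq mul1n.
Qed.

Lemma Hsnd_nats w x : size w <= dim x ->
  Hsnd w x = act 0 ((count id w).+1 :: nats (map negb w) ++
                  0 :: nseq (dim x - size w) 1) x.
Proof.
move=> wx; rewrite -{1}(stretch_nseq (dim x) x).
have Ev := nseq_true_split wx; rewrite {1}Ev Hsnd_stretch ?size_nseq //.
  by rewrite !map_nseq weave_nseq1 count_nseq mul1n.
by rewrite -Ev count_nseq mul1n.
Qed.

End Terms.

Lemma nth_weave_false w cs j : nth true w j = false -> nth 0 (weave w cs) j = 0.
Proof. by elim: w cs j => [|[] w IH] cs [|j] //= /IH ->. Qed.

(** A zero consumed by a path reappears at one of the letters true, where the
    path for the complementary word stands still by [nth_weave_false]. *)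
Lemma nth_weave_mem w cs : size cs = count id w -> 0 \in cs ->
  exists j, [/\ j < size w, nth false w j & nth 0 (weave w cs) j = 0].
Proof.
elim: w cs => [|[] w IH] cs /=; first by move/size0nil->.
  case: cs => //= c cs [scs]; rewrite inE => /predU1P[<-|/(IH _ scs)].
    by exists 0.
  by case=> j [jw wj cj]; exists j.+1.
by move=> scs /(IH _ scs)[j [jw wj cj]]; exists j.+1.
Qed.

Lemma nats_mem0 w : (0 \in nats w) = has negb w.
Proof. by elim: w => //= -[] w IH; rewrite inE IH. Qed.

(** * Words in three letters *)

(** A letter [Some true], [Some false] or [None] stands for a step of x, y or z.
    A word in these letters amounts to the pair of the binary word telling z
    from the rest and the binary word telling x from y among the rest. *)
Section Letters.
Implicit Types t : seq (option bool).

(** Inverse to taking [outer] and [inner]. It stops as soon as either argument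
    is exhausted, so that it can be used both when v goes on after the word and
    when w does. *)
Fixpoint merge (w v : bitseq) : seq (option bool) :=
  match w, v with
  | false :: w', _ => None :: merge w' v
  | true :: w', b :: v' => Some b :: merge w' v'
  | _, _ => [::]
  end.

Definition outer t : bitseq := map isSome t.
Definition inner t : bitseq := pmap id t.

Lemma merge_inner_cat t v : merge (outer t) (inner t ++ v) = t.
Proof. by elim: t => [|[b|] t IH] /=; rewrite ?IH. Qed.

Lemma merge_outer_cat t w : merge (outer t ++ true :: w) (inner t) = t.
Proof. by elim: t => [|[b|] t IH] /=; rewrite ?IH. Qed.

Lemma outer_merge w v : count id w <= size v -> outer (merge w v) = w.
Proof. by elim: w v => [|[] w IH] [|b v] //= h; rewrite IH. Qed.

Lemma inner_merge w v : count id w <= size v ->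
  inner (merge w v) = take (count id w) v.
Proof. by elim: w v => [|[] w IH] [|b v] //= h; rewrite IH. Qed.

Lemma inner_merge_lt w v : size v < count id w -> inner (merge w v) = v.
Proof. by elim: w v => [|[] w IH] [|b v] //= h; rewrite IH. Qed.

Lemma outer_merge_lt w v : size v < count id w ->
  outer (merge w v) ++ true :: drop (size (merge w v)).+1 w = w.
Proof. by elim: w v => [|[] w IH] [|b v] //= h; rewrite ?IH ?drop0. Qed.

Definition isX (l : option bool) := l == Some true.
Definition isY (l : option bool) := l == Some false.
Definition isZ (l : option bool) := l == None.

(** Cyclic exchange of the roles of the letters, after which [outer] tells x
    from the rest and [inner] tells y from z. *)
Definition rot (l : option bool) : option bool :=
  match l with
  | Some true => None | Some false => Some true | None => Some false
  end.
Definition rotV (l : option bool) : option bool :=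
  match l with
  | None => Some true | Some true => Some false | Some false => None
  end.

Lemma rotK : cancel rot rotV. Proof. by case=> [[]|]. Qed.
Lemma rotVK : cancel rotV rot. Proof. by case=> [[]|]. Qed.

Lemma count_letters t : size t = count isX t + count isY t + count isZ t.
Proof. by elim: t => //= -[[]|] t -> /=; lia. Qed.

Lemma count_rot t :
  count isX (map rot t) = count isY t /\ count isY (map rot t) = count isZ t.
Proof. by rewrite !count_map; split; apply: eq_count => -[[]|]. Qed.

Lemma count_inner t : count id (inner t) = count isX t.
Proof. by elim: t => //= -[[]|] t /= ->. Qed.

Lemma count_negb_inner t : count negb (inner t) = count isY t.
Proof. by elim: t => //= -[[]|] t /= ->. Qed.

Lemma count_outer t : count id (outer t) = count isX t + count isY t.
Proof. by elim: t => //= -[[]|] t /= ->; lia. Qed.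

Lemma count_negb_outer t : count negb (outer t) = count isZ t.
Proof. by elim: t => //= -[[]|] t /= ->. Qed.

Lemma size_inner t : size (inner t) = count isX t + count isY t.
Proof. by rewrite -count_negb count_inner count_negb_inner. Qed.

Lemma weave_inner t : weave (outer t) (nats (inner t)) = nats (map isX t).
Proof. by elim: t => //= -[[]|] t /= ->. Qed.

Lemma weave_negb_inner t :
  weave (outer t) (nats (map negb (inner t))) = nats (map isY t).
Proof. by elim: t => //= -[[]|] t /= ->. Qed.

Lemma negb_outer t : map negb (outer t) = map isZ t.
Proof. by rewrite -map_comp; apply: eq_map => -[[]|]. Qed.

Lemma map_rot (t : seq (option bool)) :
  map isX (map rot t) = map isY t /\ map isY (map rot t) = map isZ t.
Proof. by rewrite -!map_comp; split; apply: eq_map => -[[]|]. Qed.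

(** Both sides count the pairs of letters of t that are in the wrong order with
    respect to X < Y < Z. *)
Lemma inv_letters t :
  inv (outer t) + inv (inner t) = inv (map isX t) + inv (inner (map rot t)).
Proof.
elim: t => //= -[[]|] t IH /=.
- by rewrite !add0n.
- by rewrite count_inner count_id_map; lia.
rewrite count_outer !count_inner count_id_map.
by have [-> _] := count_rot t; lia.
Qed.

End Letters.

(** * Chains on products *)

Local Open Scope ring_scope.

Lemma sfst_sface (X Y : sset) i (u : simplex (X \xs Y)) :
  sfst (sface i u) = sface i (sfst u).
Proof. by case: u => [[|n] u]. Qed.

Lemma ssnd_sface (X Y : sset) i (u : simplex (X \xs Y)) :
  ssnd (sface i u) = sface i (ssnd u).
Proof. by case: u => [[|n] u]. Qed.

Lemma sfst_sdegen (X Y : sset) i (u : simplex (X \xs Y)) :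
  sfst (sdegen i u) = sdegen i (sfst u).
Proof. by case: u. Qed.

Lemma ssnd_sdegen (X Y : sset) i (u : simplex (X \xs Y)) :
  ssnd (sdegen i u) = sdegen i (ssnd u).
Proof. by case: u. Qed.

Definition sfst_stretch X Y := map_stretch (@sfst_sdegen X Y).
Definition ssnd_stretch X Y := map_stretch (@ssnd_sdegen X Y).
Definition sfst_Hfst X Y := map_Hfst (@sfst_sface X Y) (@sfst_sdegen X Y).
Definition ssnd_Hfst X Y := map_Hfst (@ssnd_sface X Y) (@ssnd_sdegen X Y).
Definition sfst_Hsnd X Y := map_Hsnd (@sfst_sface X Y) (@sfst_sdegen X Y).
Definition ssnd_Hsnd X Y := map_Hsnd (@ssnd_sface X Y) (@ssnd_sdegen X Y).

Lemma dim_sfst (X Y : sset) (u : simplex (X \xs Y)) : dim (sfst u) = dim u.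
Proof. by case: u. Qed.

Lemma dim_ssnd (X Y : sset) (u : simplex (X \xs Y)) : dim (ssnd u) = dim u.
Proof. by case: u. Qed.

Lemma simplex_pair (X Y : sset) (x : simplex X) (y : simplex Y) :
  dim x = dim y -> exists2 u : simplex (X \xs Y), sfst u = x & ssnd u = y.
Proof.
case: x y => [m x] [n y] /= mn; case: n / mn y => y.
by exists (@mksimplex (X \xs Y) m (x, y)).
Qed.

Lemma simplex_pair_inj (X Y : sset) (u v : simplex (X \xs Y)) :
  sfst u = sfst v -> ssnd u = ssnd v -> u = v.
Proof.
case: u v => [m [x y]] [n [x' y']] /= ex ey.
have /= mn : m = n by have := congr1 (@dim X) ex.
case: n / mn x' y' ex ey => x' y' ex ey.
by rewrite (eq_from_Tagged ex) (eq_from_Tagged ey).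
Qed.

Lemma spair_cls (k : comPzRingType) (X Y : sset) (u : simplex (X \xs Y)) :
  spair k (sfst u) (ssnd u) = cls k u.
Proof. by case: u => n [x y]; exact: (spairE k x y). Qed.

(** The signed sums over subsets as signed sums over words. *)
Lemma nabla_basisE (k : comPzRingType) (X Y : sset)
    (x : simplex X) (y : simplex Y) :
  nabla_basis k x y = \sum_(w <- shuf (dim x) (dim y))
    (-1) ^+ inv w *: spair k (stretch w x) (stretch (map negb w) y).
Proof.
rewrite big_filter -big_words; apply: eq_big => A; first by rewrite count_word.
move=> _; rewrite odd_shuffle_perm signr_odd !set_seq_mask word_setC.
by rewrite /stretch (mapK negbK) size_map size_word.
Qed.

Lemma Htilde_basisE (k : comPzRingType) (X Y : sset) (z : simplex (X \xs Y)) :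
  Htilde_basis k z = \sum_(w <- Hwords (dim z))
    (-1) ^+ ((size w).-1 + inv w)%N *:
    spair k (Hfst w (sfst z)) (Hsnd w (ssnd z)).
Proof.
rewrite big_allpairs_dep big_allpairs /=.
have toN (V : nmodType) n (F : nat -> V) :
  \sum_(p < n) F p = \sum_(p <- iota 0 n) F p.
  by rewrite -(big_mkord xpredT) /index_iota subn0.
rewrite /Htilde_basis -toN; apply: eq_bigr => p _.
rewrite -toN big_mkcond; apply: eq_bigr => q _.
case: ifP => pq; last by rewrite big_nil.
rewrite big_filter -big_words; apply: eq_big => A; first by rewrite count_word.
move=> /eqP Ap; rewrite !exprD odd_shuffle_perm signr_odd.
rewrite /Hfst /Hsnd /stretch size_map !size_word (mapK negbK) count_word Ap.
by rewrite !set_seq_mask word_setC; move: (word A) => w; rewrite addnS /= exprD.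
Qed.

Lemma chain_mapE (k : comPzRingType) (X Y : sset) (f : smap X Y) x :
  chain_map f (cls k x) = cls k (smap_simplex f x).
Proof. exact: chain_liftE. Qed.

Lemma linear_at0 (k : comPzRingType) (V W : lmodType k) (h : V -> W) :
  linear h -> h 0 = 0.
Proof.
by move=> hl; have := hl (-1) 0 0; rewrite scaler0 addr0 scaleN1r addNr.
Qed.

(** For maps that are linear without being bundled as such, like a tensor with
    one fixed argument. *)
Lemma linear_comb (k : comPzRingType) (V W : lmodType k) (h : V -> W)
    (I : Type) (s : seq I) (a : I -> k) (d : I -> V) : linear h ->
  h (\sum_(i <- s) a i *: d i) = \sum_(i <- s) a i *: h (d i).
Proof.
move=> hl; have h0 := linear_at0 hl.
elim: s => [|i s IH]; first by rewrite !big_nil.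
by rewrite !big_cons hl IH.
Qed.

Lemma chain_map_linear (k : comPzRingType) (X Y : sset) (f : smap X Y) :
  linear (chain_map (k := k) f).
Proof. exact: linearP. Qed.

Lemma chain_map_comb (k : comPzRingType) (X Y : sset) (f : smap X Y)
    (I : Type) (s : seq I) a d :
  chain_map f (\sum_(i <- s) a i *: d i) =
  \sum_(i <- s) a i *: chain_map (k := k) f (d i).
Proof. apply: linear_comb; exact: chain_map_linear. Qed.

Lemma Htilde_comb (k : comPzRingType) (X Y : sset) (I : Type) (s : seq I) a d :
  Htilde k X Y (\sum_(i <- s) a i *: d i) =
  \sum_(i <- s) a i *: Htilde k X Y (d i).
Proof. apply: linear_comb; exact: linearP. Qed.

Section Triples.
Variables (k : comPzRingType) (X Y Z : sset).
Implicit Types (x : simplex X) (y : simplex Y) (z : simplex Z).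

(** The simplex (x, y, z) as a chain on the triple product, extended by 0 to
    simplices of different dimensions so that no proof of equality of dimensions
    has to be carried along. *)
Definition tri x y z : chains k (X \xs Y \xs Z) :=
  if pselect (exists u : simplex (X \xs Y \xs Z),
    [/\ sfst (sfst u) = x, ssnd (sfst u) = y & ssnd u = z]) is left h
  then cls k (projT1 (cid h)) else 0.

Lemma triE (u : simplex (X \xs Y \xs Z)) :
  tri (sfst (sfst u)) (ssnd (sfst u)) (ssnd u) = cls k u.
Proof.
rewrite /tri; case: pselect => [h|[]]; last by exists u.
case: (cid h) => v /= [e1 e2 e3].
by rewrite (simplex_pair_inj (simplex_pair_inj e1 e2) e3).
Qed.

Lemma tri_neq x y z : ~ (dim x = dim y /\ dim y = dim z) -> tri x y z = 0.
Proof.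
move=> ne; rewrite /tri; case: pselect => // -[u [ux uy uz]]; case: ne.
by rewrite -ux -uy -uz !dim_sfst !dim_ssnd !dim_sfst.
Qed.

Lemma triP x y z : dim x = dim y -> dim y = dim z ->
  exists u : simplex (X \xs Y \xs Z),
    [/\ sfst (sfst u) = x, ssnd (sfst u) = y & ssnd u = z].
Proof.
move=> xy yz; have [v vx vy] := simplex_pair xy.
have [|u uv uz] := @simplex_pair _ _ v z; first by rewrite -yz -vy dim_ssnd.
by exists u; rewrite uv.
Qed.

(** This is where normalization of chains enters. *)
Lemma tri_degenerate i x y z : degenerate_at i x -> degenerate_at i y ->
  degenerate_at i z -> tri x y z = 0.
Proof.
move=> [x' ix ->] [y' iy ->] [z' iz ->].
have [[xy yz]|/tri_neq //] := EM (dim (sdegen i x') = dim (sdegen i y') /\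
  dim (sdegen i y') = dim (sdegen i z')).
have [||u [<- <- uz]] := @triP x' y' z'.
- by move: xy; rewrite !dim_sdegen => -[].
- by move: yz; rewrite !dim_sdegen => -[].
rewrite -uz -sfst_sdegen -!ssnd_sdegen -!sfst_sdegen triE.
by apply: cls_degenerate; exists i, u; rewrite // -(dim_ssnd u) uz.
Qed.

Lemma spair_tri (u : simplex (X \xs Y)) z :
  spair k u z = tri (sfst u) (ssnd u) z.
Proof.
have [e|ne] := eqVneq (dim u) (dim z).
  by have [v <- <-] := simplex_pair e; rewrite spair_cls triE.
rewrite spair_neq // tri_neq // dim_sfst dim_ssnd => -[_ e].
by rewrite e eqxx in ne.
Qed.

Lemma spair_sassoc x (u : simplex (Y \xs Z)) :
  chain_map (sassoc X Y Z) (spair k x u) = tri x (sfst u) (ssnd u).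
Proof.
have [e|ne] := eqVneq (dim x) (dim u).
  have [v <- <-] := simplex_pair e; rewrite spair_cls chain_mapE -triE.
  by case: v {e} => n [a [b c]].
rewrite spair_neq // linear0 tri_neq // dim_sfst => -[e _].
by rewrite e eqxx in ne.
Qed.

Lemma sassocK :
  cancel (chain_map (k := k) (sassoc X Y Z)) (chain_map (sassocV X Y Z)).
Proof.
elim/chains_ind => [u||a c d IH IH'].
- by rewrite !chain_mapE; case: u => n [a [b c]].
- by rewrite !linear0.
by rewrite !chain_map_linear IH IH'.
Qed.

Lemma spair_sassocV x (u : simplex (Y \xs Z)) :
  spair k x u = chain_map (sassocV X Y Z) (tri x (sfst u) (ssnd u)).
Proof. by rewrite -spair_sassoc sassocK. Qed.

(** The homotopy for (X \xs Y) and Z applies its first operator to both x and y,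
    and the one for X and (Y \xs Z) its second to both y and z. *)
Lemma Htilde_tri x y z : dim x = dim y -> dim y = dim z ->
  Htilde k (X \xs Y) Z (tri x y z) = \sum_(w <- Hwords (dim x))
    (-1) ^+ ((size w).-1 + inv w)%N *: tri (Hfst w x) (Hfst w y) (Hsnd w z).
Proof.
move=> xy yz; have [u [<- <- <-]] := triP xy yz.
rewrite triE HtildeE Htilde_basisE !dim_sfst; apply: eq_bigr => w _.
by rewrite spair_tri sfst_Hfst ssnd_Hfst.
Qed.

Lemma Htilde_triV x y z : dim x = dim y -> dim y = dim z ->
  Htilde k X (Y \xs Z) (chain_map (sassocV X Y Z) (tri x y z)) =
  chain_map (sassocV X Y Z) (\sum_(w <- Hwords (dim x))
    (-1) ^+ ((size w).-1 + inv w)%N *: tri (Hfst w x) (Hsnd w y) (Hsnd w z)).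
Proof.
move=> xy yz; have [u [<- <- <-]] := triP xy yz.
rewrite triE chain_mapE HtildeE Htilde_basisE chain_map_comb.
have -> : dim (smap_simplex (sassocV X Y Z) u) = dim (sfst (sfst u)).
  by case: (u) => n [[a b] c].
apply: eq_bigr => w _; rewrite spair_sassocV; congr (_ *: chain_map _ _).
by rewrite sfst_Hsnd ssnd_Hsnd; case: (u) => n [[a b] c].
Qed.

End Triples.

Section Linear.
Variables (k : comPzRingType).

(** Tensors of simplices generate the tensor product of the chain modules. *)
Lemma tensor_ext (X Y : sset) (P : lmodType k)
    (f g : {linear tensor (chains k X) (chains k Y) -> P}) :
  (forall x y, f (tens (cls k x) (cls k y)) = g (tens (cls k x) (cls k y))) ->
  f =1 g.
Proof.
move=> fg.
have fgt c d : f (tens c d) = g (tens c d).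
  elim/chains_ind: c => [x||a c c' IH IH'].
  - elim/chains_ind: d => [y||a d d' IH IH']; first exact: fg.
      by rewrite (linear_at0 (tens_linear_r _)) !linear0.
    by rewrite tens_linear_r !linearP IH IH'.
  - by rewrite (linear_at0 (tens_linear_l d)) !linear0.
  - by rewrite tens_linear_l !linearP IH IH'.
move=> t; rewrite -[t]qreprK -[qrepr t]freelift_genK /freelift !linear_sum /=.
apply: eq_bigr => -[c d] _; rewrite !linearZ; congr (_ *: _); exact: fgt.
Qed.

Lemma nabla_comb_r (X Y : sset) c (I : Type) (s : seq I) (a : I -> k) d :
  nabla k X Y (tens c (\sum_(i <- s) a i *: d i)) =
  \sum_(i <- s) a i *: nabla k X Y (tens c (d i)).
Proof.
apply: (linear_comb (h := fun d => nabla k X Y (tens c d))) => b y y'.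
by rewrite tens_linear_r linearP.
Qed.

Lemma nabla_comb_l (X Y : sset) c (I : Type) (s : seq I) (a : I -> k) d :
  nabla k X Y (tens (\sum_(i <- s) a i *: d i) c) =
  \sum_(i <- s) a i *: nabla k X Y (tens (d i) c).
Proof.
apply: (linear_comb (h := fun d => nabla k X Y (tens d c))) => b x x'.
by rewrite tens_linear_l linearP.
Qed.

End Linear.

(** * Reindexing the two double sums *)

Lemma mem_pairs (S T : eqType) (s : seq S) (t : seq T) a b :
  ((a, b) \in [seq (a, b) | a <- s, b <- t]) = (a \in s) && (b \in t).
Proof.
apply/allpairsP/andP => [[[a' b'] [/= sa tb [-> ->]]] //|[sa tb]].
by exists (a, b).
Qed.

(** The composites on the right-hand sides: a shuffle w ++ true :: w' applied to
    a term of the homotopy, the displayed letter true being the jump. *)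
Lemma stretch_act_cat (W : sset) (u : simplex W) w w' a cs b m :
  valid 0 (a :: cs ++ b :: nseq m 1%N) (dim u) -> size cs = count id w ->
  m = count id w' ->
  stretch (w ++ true :: w') (act 0 (a :: cs ++ b :: nseq m 1%N) u) =
  act 0 (a :: weave w cs ++ b :: nats w') u.
Proof.
move=> vu scs mE; rewrite -[cs ++ _]cats0 stretch_act ?cats0 //.
  by rewrite weave_cat //= weave_nseq1.
by rewrite size_cat /= size_nseq count_cat /= scs mE.
Qed.

Lemma split_three (w v : bitseq) : (size w <= size v)%N -> exists v1 v2 v3,
  [/\ v = v1 ++ v2 ++ v3, size v1 = count id w & size v2 = count negb w]%N.
Proof.
have := count_negb w => cw wv.
exists (take (count id w) v), (take (count negb w) (drop (count id w) v)),
  (drop (count negb w) (drop (count id w) v)).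
by rewrite !cat_take_drop !size_takel ?size_drop //; lia.
Qed.

Section Combinatorics.
Variables (k : comPzRingType) (X Y Z : sset).
Variables (x : simplex X) (y : simplex Y) (z : simplex Z).

Lemma tri_act_degenerate (cx cy cz : seq nat) j :
  valid 0 cx (dim x) -> valid 0 cy (dim y) -> valid 0 cz (dim z) ->
  (j.+1 < size cx)%N -> size cy = size cx -> size cz = size cx ->
  nth 0%N cx j.+1 = 0%N -> nth 0%N cy j.+1 = 0%N -> nth 0%N cz j.+1 = 0%N ->
  tri k (act 0 cx x) (act 0 cy y) (act 0 cz z) = 0.
Proof.
move=> wx wy wz jx sy sz x0 y0 z0.
by apply: (tri_degenerate _ (i := j)); apply: degenerate_act; rewrite ?sy ?sz.
Qed.

Section First.
Variables (r n : nat).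
Hypotheses (xr : dim x = r) (yn : dim y = n) (zn : dim z = n).

Let lhs (i : bitseq * bitseq) := let: (v, w) := i in
  (-1) ^+ (inv v + ((size w).-1 + inv w))%N *:
  tri k (Hfst w (stretch v x)) (Hfst w (stretch (map negb v) y))
      (Hsnd w (stretch (map negb v) z)).

Let rhs (i : bitseq * bitseq) := let: (w, v) := i in
  (-1) ^+ (r + ((size w).-1 + inv w) + inv v)%N *:
  tri k (stretch v x) (stretch (map negb v) (Hfst w y))
      (stretch (map negb v) (Hsnd w z)).

(** The pairs (t, v) of a word before the jump and a word after it that occur in
    the first identity; a letter true of v is a step of x, a letter false one of
    y and z. There must be a Z because the homotopy has at least one step of its
    second factor. *)
Definition letters1 (i : seq (option bool) * bitseq) : Prop :=
  [/\ (count isX i.1 + count id i.2 = r)%N,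
      (count isY i.1 + count isZ i.1 + count negb i.2 = n)%N &
      (0 < count isZ i.1)%N].

(** The surviving indices on the left: the first factor (x, y) goes through the
    X and Y of t, and the second factor retraces the Z as steps of y and z. *)
Definition lhs1_of (i : seq (option bool) * bitseq) : bitseq * bitseq :=
  (inner i.1 ++ nseq (count isZ i.1) false ++ i.2, outer i.1).
Definition lhs1_letters (i : bitseq * bitseq) : seq (option bool) * bitseq :=
  (merge i.2 i.1, drop (size i.2) i.1).

(** On the right t loses its X to become a path of the homotopy for (y, z), and
    the X are the letters true of the shuffle. The extra letter false is the
    jump, which moves y. *)
Definition rhs1_of (i : seq (option bool) * bitseq) : bitseq * bitseq :=
  (inner (map rot i.1), map isX i.1 ++ false :: i.2).
Definition rhs1_letters (i : bitseq * bitseq) : seq (option bool) * bitseq :=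
  let t := merge (map negb i.2) i.1 in (map rotV t, drop (size t).+1 i.2).

Lemma lhs1_ofP (i : seq (option bool) * bitseq) : letters1 i ->
  lhs1_of i \in [seq (v, w) | v <- shuf r n, w <- Hwords (r + n)] /\
  lhs1_letters (lhs1_of i) = i.
Proof.
case: i => t v [/= hr hn hz]; have ct := count_letters t; split.
  have cv := count_negb v.
  rewrite mem_pairs mem_shuf mem_Hwords; apply/andP; split.
    rewrite !size_cat !count_cat size_inner count_inner size_nseq count_nseq /=.
    by apply/andP; split; apply/eqP; lia.
  rewrite has_count count_negb_outer size_map ct; apply/andP; split=> //; lia.
rewrite /lhs1_of /lhs1_letters /= merge_inner_cat catA drop_size_cat //.
by rewrite size_cat size_inner size_nseq size_map ct.
Qed.

Lemma map_isX_outer t : map isX t = map negb (outer (map rot t)).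
Proof. by rewrite -!map_comp; apply: eq_map => -[[]|]. Qed.

Lemma rhs1_ofP (i : seq (option bool) * bitseq) : letters1 i ->
  rhs1_of i \in [seq (w, v) | w <- Hwords n, v <- shuf r n.+1] /\
  rhs1_letters (rhs1_of i) = i.
Proof.
case: i => t v [/= hr hn hz]; have ct := count_letters t; split.
  have cv := count_negb v; have [cX cY] := count_rot t.
  rewrite mem_pairs mem_shuf mem_Hwords; apply/andP; split.
    rewrite has_count count_negb_inner size_inner cX cY; apply/andP; split; lia.
  rewrite size_cat count_cat size_map count_id_map /=.
  by apply/andP; split; apply/eqP; lia.
rewrite /rhs1_of /rhs1_letters /= map_cat map_isX_outer (mapK negbK) /=.
rewrite merge_outer_cat (mapK rotK) -cat_rcons drop_size_cat //.
by rewrite size_rcons !size_map.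
Qed.

Lemma rhs1_lettersP (j : bitseq * bitseq) :
  j \in [seq (w, v) | w <- Hwords n, v <- shuf r n.+1] ->
  letters1 (rhs1_letters j) /\ rhs1_of (rhs1_letters j) = j.
Proof.
case: j => w v; rewrite mem_pairs mem_Hwords mem_shuf has_count.
move=> /andP[/andP[wn w0] /andP[/eqP sv /eqP cv]].
rewrite /rhs1_letters /rhs1_of /=.
have cv' := count_negb v.
have lt : (size w < count id (map negb v))%N by rewrite count_map_negb; lia.
set t := merge _ _; have Ew : inner t = w by apply: inner_merge_lt.
have Ev : map negb (outer t) ++ false :: drop (size t).+1 v = v.
  have := outer_merge_lt lt; rewrite -/t => /(congr1 (map negb)).
  by rewrite map_cat /= map_drop (mapK negbK).
have Et : map rot (map rotV t) = t by rewrite (mapK rotVK).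
have EX : map isX (map rotV t) = map negb (outer t) by rewrite map_isX_outer Et.
split; last by rewrite Et EX Ew Ev.
move: (map rotV t) Et EX (drop _ v) Ev => t' Et EX v3 Ev.
have [cX cY] := count_rot t'; rewrite {}Et in cX cY.
have sw := size_inner t; have nw := count_negb_inner t; rewrite Ew in sw nw.
have c1 : (count isX t' + count id v3 = count id v)%N.
  by rewrite -Ev -EX count_cat count_id_map.
have c2 : (size t' + (size v3).+1 = size v)%N.
  by rewrite -Ev size_cat -EX size_map.
have ct := count_letters t'; have c3 := count_negb v3.
by split=> /=; lia.
Qed.

(** If v2, the stretch of the shuffle covered by the second factor, contains a
    step of x, the corresponding step of z stands still. *)
Lemma lhs1_lettersP (j : bitseq * bitseq) :
  j \in [seq (v, w) | v <- shuf r n, w <- Hwords (r + n)] ->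
  lhs j = 0 \/ letters1 (lhs1_letters j) /\ lhs1_of (lhs1_letters j) = j.
Proof.
case: j => v w; rewrite mem_pairs mem_Hwords mem_shuf has_count.
move=> /andP[/andP[/eqP sv /eqP cv] /andP[wn w0]].
rewrite /lhs1_letters /lhs1_of /=.
have cw := count_negb w; have cv' := count_negb v.
have pv : (count id w <= size v)%N by lia.
have [|v1 [v2 [v3 [Ev s1 s2]]]] := @split_three w v; first by lia.
have [v2X|v2X] := boolP (has id v2); [left|right].
  rewrite /lhs.
  have wneg := count_map_negb w.
  have cx : count id (v1 ++ v2 ++ v3) = dim x by rewrite -Ev xr.
  have cy : count id (map negb v1 ++ map negb v2 ++ map negb v3) = dim y.
    by rewrite -!map_cat -Ev count_map_negb; lia.
  have cz : count id (map negb v1 ++ map negb v2 ++ map negb v3) = dim z.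
    by rewrite cy yn zn.
  have [||j [jw wj vj]] := @nth_weave_mem (map negb w) (nats (map negb v2)).
  - by rewrite !size_map s2 wneg.
  - by rewrite nats_mem0 has_map (eq_has (a2 := id)) // => b; rewrite /= negbK.
  rewrite size_map in jw.
  have wj' : nth true w j = false.
    by move: wj; rewrite (nth_map true) //; case: nth.
  rewrite Ev !map_cat.
  rewrite Hfst_stretch ?Hfst_stretch ?Hsnd_stretch ?size_map //; try lia.
  rewrite (@tri_act_degenerate _ _ _ j) ?scaler0 //.
  - exact: valid_Hfst.
  - by apply: valid_Hfst; rewrite ?size_map.
  - by apply: valid_Hsnd; rewrite ?size_map.
  - by rewrite /= size_cat size_weave; lia.
  - by rewrite /= !size_cat !size_weave /= !size_map.
  - by rewrite /= !size_cat !size_weave /= !size_map.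
  - by rewrite /= nth_cat size_weave jw nth_weave_false.
  - by rewrite /= nth_cat size_weave jw nth_weave_false.
  - by rewrite /= nth_cat size_weave size_map jw.
have Em := outer_merge pv; have Ei := inner_merge pv.
have v2E : v2 = nseq (count negb w) false.
  rewrite -s2; apply/all_pred1P; rewrite -all_predC in v2X.
  by apply: sub_all v2X => -[].
rewrite Ev -s1 take_size_cat // -Ev in Ei.
have Ed : drop (size w) v = v3.
  by rewrite Ev catA drop_size_cat // size_cat s1 s2.
rewrite Ed; move: (merge w v) Em Ei => t Em Ei.
have tX := count_inner t; have tY := count_negb_inner t.
have tZ := count_negb_outer t; rewrite Em in tZ; rewrite Ei in tX tY.
have cE := Ev; rewrite v2E in cE.
split; last by rewrite Em Ei -tZ -cE.
have cX := congr1 (count id) cE; have cN := congr1 (count negb) cE.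
rewrite !count_cat !count_nseq /= in cX cN.
by split=> /=; lia.
Qed.

(** The two exponents differ by twice the number of steps of x in v. *)
Lemma lhs1_rhs1 i : letters1 i -> lhs (lhs1_of i) = rhs (rhs1_of i).
Proof.
case: i => t v [/= hr hn hz]; have ct := count_letters t.
have cv := count_negb v; have [cX cY] := count_rot t.
have cXn : count negb (map isX t) = (count isY t + count isZ t)%N.
  have := count_negb (map isX t); rewrite count_id_map size_map ct; lia.
rewrite /lhs /rhs /lhs1_of /rhs1_of /=; congr (_ *: _).
  (* Multiply by the square that makes the two exponents equal. *)
  rewrite -[LHS]mulr1 -[X in _ * X = _](sqrr_sign k (count id v)) -exprM -exprD.
  congr (_ ^+ _); have := inv_letters t.
  rewrite !inv_cat inv_nseq !size_map size_inner cX cY ct cXn.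
  rewrite count_negb_inner count_cat !count_nseq /= !mul0n !mul1n !add0n.
  by move: hz; rewrite -hr !mulnDl; lia.
have cx : count id (inner t ++ nseq (count isZ t) false ++ v) = dim x.
  by rewrite !count_cat count_inner count_nseq /= xr; lia.
have cy : count negb (inner t ++ nseq (count isZ t) false ++ v) = n.
  by rewrite !count_cat count_negb_inner count_nseq /=; lia.
have szi : size (inner t) = count id (outer t).
  by rewrite size_inner count_outer.
have cO := count_negb_outer t.
rewrite !map_cat !map_nseq /=.
have cyn := count_map_negb (inner t ++ nseq (count isZ t) false ++ v).
rewrite !map_cat !map_nseq cy /= in cyn.
congr tri.
- rewrite Hfst_stretch ?size_nseq ?cO // weave_inner count_nseq mul0n.
  by rewrite stretch_nats ?map_cat // count_cat count_id_map /= xr.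
- rewrite Hfst_stretch ?size_map ?size_nseq ?cyn ?yn ?cO // weave_negb_inner.
  rewrite count_nseq mul1n Hfst_nats ?yn; last 2 first.
  + by rewrite size_inner cX cY; lia.
  + by rewrite has_count count_negb_inner cY.
  rewrite map_isX_outer (mapK negbK) stretch_act_cat.
  + by rewrite weave_inner count_negb_inner cY; have [-> _] := map_rot t.
  + rewrite !sumE sumn_nats sumn_nseq yn count_inner count_negb_inner.
    by rewrite size_inner cX cY; lia.
  + by rewrite size_map -count_negb count_inner count_negb_inner count_outer.
  by rewrite size_inner cX cY count_map_negb; lia.
rewrite Hsnd_stretch ?size_map ?size_nseq ?cyn ?zn ?cO //.
rewrite count_map_negb count_negb_inner map_nseq weave_nseq1 negb_outer.
rewrite Hsnd_nats ?zn; last by rewrite size_inner cX cY; lia.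
rewrite map_isX_outer (mapK negbK) stretch_act_cat.
- rewrite count_inner cX weave_negb_inner.
  by have [_ ->] := map_rot t.
- rewrite !sumE sumn_nats sumn_nseq zn count_map_negb count_inner.
  by rewrite count_negb_inner size_inner cX cY; lia.
- by rewrite !size_map -count_negb count_inner count_negb_inner count_outer.
by rewrite size_inner cX cY count_map_negb; lia.
Qed.

Lemma first_sum_identity :
  \sum_(v <- shuf r n) \sum_(w <- Hwords (r + n)) lhs (v, w) =
  \sum_(w <- Hwords n) \sum_(v <- shuf r n.+1) rhs (w, v).
Proof.
rewrite -!big_allpairs.
apply: (big_bij _ _ lhs1_ofP rhs1_ofP rhs1_lettersP lhs1_lettersP lhs1_rhs1).
- by apply: allpairs_uniq; rewrite ?shuf_uniq ?Hwords_uniq // => -[? ?] [? ?].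
- by apply: allpairs_uniq; rewrite ?shuf_uniq ?Hwords_uniq // => -[? ?] [? ?].
Qed.

End First.

Section Second.
Variables (r n : nat).
Hypotheses (xn : dim x = n) (yn : dim y = n) (zr : dim z = r).

Let lhs (i : bitseq * bitseq) := let: (v, w) := i in
  (-1) ^+ (inv v + ((size w).-1 + inv w))%N *:
  tri k (Hfst w (stretch v x)) (Hsnd w (stretch v y))
      (Hsnd w (stretch (map negb v) z)).

Let rhs (i : bitseq * bitseq) := let: (w, v) := i in
  (-1) ^+ ((size w).-1 + inv w + inv v)%N *:
  tri k (stretch v (Hfst w x)) (stretch v (Hsnd w y)) (stretch (map negb v) z).

(** Here a letter true of v is a step of x and y, a letter false one of z. There
    must be a Y because these are the steps of x that the jump makes up for. *)
Definition letters2 (i : seq (option bool) * bitseq) : Prop :=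
  [/\ (count isX i.1 + count isY i.1 + count id i.2 = n)%N,
      (count isZ i.1 + count negb i.2 = r)%N &
      (0 < count isY i.1)%N].

(** On the left the first factor x takes the X of t, and the second factor
    (y, z) the Y and Z; the shuffle takes the X first, and each Y as a step of
    x and y. *)
Definition lhs2_of (i : seq (option bool) * bitseq) : bitseq * bitseq :=
  (nseq (count isX i.1) true ++ inner (map rot i.1) ++ i.2, map isX i.1).
Definition lhs2_letters (i : bitseq * bitseq) : seq (option bool) * bitseq :=
  (map rotV (merge (map negb i.2) (drop (count id i.2) i.1)),
   drop (size i.2) i.1).

(** On the right the Z of t are the steps of z in the shuffle, and the extra
    letter true is the jump, which moves x. *)
Definition rhs2_of (i : seq (option bool) * bitseq) : bitseq * bitseq :=
  (inner i.1, outer i.1 ++ true :: i.2).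
Definition rhs2_letters (i : bitseq * bitseq) : seq (option bool) * bitseq :=
  let t := merge i.2 i.1 in (t, drop (size t).+1 i.2).

Lemma lhs2_ofP (i : seq (option bool) * bitseq) : letters2 i ->
  lhs2_of i \in [seq (v, w) | v <- shuf n r, w <- Hwords (n + r)] /\
  lhs2_letters (lhs2_of i) = i.
Proof.
case: i => t v [/= hn hr hy]; have ct := count_letters t.
have [cX cY] := count_rot t; split.
  have cv := count_negb v.
  rewrite mem_pairs mem_shuf mem_Hwords; apply/andP; split.
    rewrite !size_cat !count_cat size_inner count_inner size_nseq count_nseq /=.
    by rewrite cX cY; apply/andP; split; apply/eqP; lia.
  rewrite has_count -count_map_negb map_isX_outer (mapK negbK) count_outer.
  by rewrite cX cY !size_map ct; apply/andP; split; lia.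
rewrite /lhs2_of /lhs2_letters /= count_id_map drop_size_cat ?size_nseq //.
rewrite map_isX_outer (mapK negbK) merge_inner_cat (mapK rotK) catA.
rewrite drop_size_cat // size_cat size_inner size_nseq !size_map ct cX cY.
by rewrite addnA.
Qed.

Lemma rhs2_ofP (i : seq (option bool) * bitseq) : letters2 i ->
  rhs2_of i \in [seq (w, v) | w <- Hwords n, v <- shuf n.+1 r] /\
  rhs2_letters (rhs2_of i) = i.
Proof.
case: i => t v [/= hn hr hy]; have ct := count_letters t; split.
  have cv := count_negb v.
  rewrite mem_pairs mem_shuf mem_Hwords; apply/andP; split.
    by rewrite has_count count_negb_inner size_inner /=; apply/andP; split; lia.
  rewrite size_cat count_cat size_map count_outer /=.
  by apply/andP; split; apply/eqP; lia.
rewrite /rhs2_of /rhs2_letters /= merge_outer_cat -cat_rcons drop_size_cat //.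
by rewrite size_rcons !size_map.
Qed.

Lemma rhs2_lettersP (j : bitseq * bitseq) :
  j \in [seq (w, v) | w <- Hwords n, v <- shuf n.+1 r] ->
  letters2 (rhs2_letters j) /\ rhs2_of (rhs2_letters j) = j.
Proof.
case: j => w v; rewrite mem_pairs mem_Hwords mem_shuf has_count.
move=> /andP[/andP[wn w0] /andP[/eqP sv /eqP cv]].
rewrite /rhs2_letters /rhs2_of /=.
have cv' := count_negb v.
have lt : (size w < count id v)%N by lia.
have Ew := inner_merge_lt lt; have Ev := outer_merge_lt lt.
split; last by rewrite Ew Ev.
move: (merge v w) Ew (drop _ v) Ev => t Ew v3 Ev.
have sw := size_inner t; have nw := count_negb_inner t; rewrite Ew in sw nw.
have c1 : (count isX t + count isY t + (count id v3).+1 = count id v)%N.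
  by rewrite -Ev count_cat count_outer.
have c2 : (size t + (size v3).+1 = size v)%N.
  by rewrite -Ev size_cat size_map.
have ct := count_letters t; have c3 := count_negb v3.
by split=> /=; lia.
Qed.

(** A term vanishes if v1, the part of the shuffle covered by the first factor,
    contains a step of z, since the corresponding step of x stands still, or if
    v2 consists of steps of z only, since then the jump moves nothing. *)
Lemma lhs2_lettersP (j : bitseq * bitseq) :
  j \in [seq (v, w) | v <- shuf n r, w <- Hwords (n + r)] ->
  lhs j = 0 \/ letters2 (lhs2_letters j) /\ lhs2_of (lhs2_letters j) = j.
Proof.
case: j => v w; rewrite mem_pairs mem_Hwords mem_shuf has_count.
move=> /andP[/andP[/eqP sv /eqP cv] /andP[wn w0]].
rewrite /lhs2_letters /lhs2_of /=.
have cw := count_negb w; have cv' := count_negb v.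
have [|v1 [v2 [v3 [Ev s1 s2]]]] := @split_three w v; first by lia.
have wneg := count_map_negb w.
have cx : count id (v1 ++ v2 ++ v3) = dim x by rewrite -Ev xn.
have cy : count id (v1 ++ v2 ++ v3) = dim y by rewrite -Ev yn.
have cz : count id (map negb v1 ++ map negb v2 ++ map negb v3) = dim z.
  by rewrite -!map_cat -Ev count_map_negb; lia.
have zero j : (j < (size w).+1)%N ->
    nth 0%N (weave w (nats v1) ++ count id v2 :: nats v3) j = 0%N ->
    nth 0%N (weave (map negb w) (nats v2) ++ 0%N :: nats v3) j = 0%N ->
    nth 0%N (weave (map negb w) (nats (map negb v2)) ++
             0%N :: nats (map negb v3)) j = 0%N -> lhs (v, w) = 0.
  move=> jw x0 y0 z0; rewrite /lhs Ev !map_cat.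
  rewrite Hfst_stretch ?Hsnd_stretch ?size_map //; try lia.
  rewrite (@tri_act_degenerate _ _ _ j) ?scaler0 //.
  - exact: valid_Hfst.
  - exact: valid_Hsnd.
  - by apply: valid_Hsnd; rewrite ?size_map.
  - by rewrite /= size_cat size_weave /=; lia.
  - by rewrite /= !size_cat !size_weave /= !size_map.
  - by rewrite /= !size_cat !size_weave /= !size_map.
have [v1Z|v1X] := boolP (has negb v1); first left.
  have [||j [jw wj vj]] := @nth_weave_mem w (nats v1).
  - by rewrite !size_map s1.
  - by rewrite nats_mem0.
  have wj' : nth true (map negb w) j = false.
    by rewrite (nth_map false) // wj.
  apply: (zero j); first exact: ltnW.
  - by rewrite nth_cat size_weave jw.
  - by rewrite nth_cat size_weave size_map jw nth_weave_false.
  - by rewrite nth_cat size_weave size_map jw nth_weave_false.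
have [v2X|v2Z] := boolP (has id v2); [right|left]; last first.
  (* The jump comes right after the steps of w. *)
  apply: (zero (size w)) => //.
  - rewrite nth_cat size_weave ltnn subnn /=.
    by apply/eqP; rewrite -leqn0 leqNgt -has_count.
  - by rewrite nth_cat size_weave size_map ltnn subnn.
  - by rewrite nth_cat size_weave size_map ltnn subnn.
have v1E : v1 = nseq (count id w) true.
  rewrite -s1; apply/all_pred1P; rewrite -all_predC in v1X.
  by apply: sub_all v1X => -[].
have pv : (count id (map negb w) <= size (v2 ++ v3))%N.
  by rewrite wneg size_cat s2; lia.
have Em := outer_merge pv; have Ei := inner_merge pv.
rewrite wneg -s2 take_size_cat // in Ei.
have Ed : drop (size w) v = v3.
  by rewrite Ev catA drop_size_cat // size_cat s1 s2.
have -> : drop (count id w) v = v2 ++ v3 by rewrite Ev drop_size_cat.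
rewrite {}Ed; set t := merge _ _ in Em Ei *.
have Et : map rot (map rotV t) = t by rewrite (mapK rotVK).
have EX : map isX (map rotV t) = w.
  by rewrite map_isX_outer Et Em (mapK negbK).
have cE := Ev; rewrite v1E in cE.
have tX : count isX (map rotV t) = count id w by rewrite -count_id_map EX.
split; last by rewrite Et EX tX Ei -cE.
have [cX cY] := count_rot (map rotV t); rewrite Et in cX cY.
have tY := count_inner t; have tZ := count_negb_inner t.
rewrite Ei in tY tZ; rewrite has_count in v2X.
have eX := congr1 (count id) cE; have eN := congr1 (count negb) cE.
rewrite !count_cat !count_nseq /= in eX eN.
by split=> /=; lia.
Qed.

Lemma lhs2_rhs2 i : letters2 i -> lhs (lhs2_of i) = rhs (rhs2_of i).
Proof.
case: i => t v [/= hn hr hy]; have ct := count_letters t.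
have cv := count_negb v; have [cX cY] := count_rot t.
have [mX mY] := map_rot t.
have szi : size (inner (map rot t)) = count negb (map isX t).
  have := count_negb (map isX t).
  by rewrite count_id_map size_map size_inner cX cY ct; lia.
rewrite /lhs /rhs /lhs2_of /rhs2_of /=; congr (_ *: _).
  congr (_ ^+ _); have := inv_letters t.
  rewrite !inv_cat inv_nseq !size_map size_inner ct count_negb_outer.
  rewrite count_negb_inner count_nseq cY /= !mul0n !add0n !mulnDr muln1.
  by lia.
have cn : count id (nseq (count isX t) true ++ inner (map rot t) ++ v) = n.
  by rewrite !count_cat count_inner count_nseq cX /=; lia.
have cz : count id (map negb (nseq (count isX t) true) ++
    map negb (inner (map rot t)) ++ map negb v) = dim z.
  rewrite -!map_cat count_map_negb !count_cat count_negb_inner count_nseq.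
  by rewrite cY zr /=; lia.
have szn : size (nseq (count isX t) true) = count id (map isX t).
  by rewrite size_nseq count_id_map.
have isz : (0 < size (inner (map rot t)))%N by rewrite size_inner cX; lia.
have itn : (size (inner t) <= n)%N by rewrite size_inner; lia.
have K : (n - size (inner t))%N = count id v by rewrite size_inner; lia.
have ws : weave (map negb (map isX t)) (nats (inner (map rot t))) =
          nats (map isY t).
  by rewrite map_isX_outer (mapK negbK) weave_inner mX.
have szc : size (inner t) = count id (outer t).
  by rewrite size_inner count_outer.
congr tri.
- rewrite Hfst_stretch ?xn // map_nseq weave_nseq1 count_inner cX.
  rewrite Hfst_nats ?xn ?has_count ?count_negb_inner // K stretch_act_cat //.
  + by rewrite weave_inner.
  + by rewrite !sumE sumn_nats sumn_nseq xn count_inner; lia.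
  + by rewrite size_map.
- rewrite Hsnd_stretch ?yn // ws count_nseq mul1n Hsnd_nats ?yn // K.
  rewrite stretch_act_cat ?size_map //.
  + by rewrite weave_negb_inner count_inner.
  + rewrite !sumE sumn_nats sumn_nseq yn count_map_negb count_inner.
    by rewrite count_negb_inner; lia.
rewrite !map_cat Hsnd_stretch ?size_map //; try by rewrite ?size_nseq.
rewrite map_nseq count_nseq /= map_isX_outer (mapK negbK) weave_negb_inner mY.
rewrite stretch_nats ?map_cat /= ?negb_outer //.
by rewrite count_cat /= count_id_map count_map_negb zr.
Qed.

Lemma second_sum_identity :
  \sum_(v <- shuf n r) \sum_(w <- Hwords (n + r)) lhs (v, w) =
  \sum_(w <- Hwords n) \sum_(v <- shuf n.+1 r) rhs (w, v).
Proof.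
rewrite -!big_allpairs.
apply: (big_bij _ _ lhs2_ofP rhs2_ofP rhs2_lettersP lhs2_lettersP lhs2_rhs2).
- by apply: allpairs_uniq; rewrite ?shuf_uniq ?Hwords_uniq // => -[? ?] [? ?].
- by apply: allpairs_uniq; rewrite ?shuf_uniq ?Hwords_uniq // => -[? ?] [? ?].
Qed.

End Second.
End Combinatorics.

(** * The identities on chains *)

Lemma dim_stretch (X : sset) w (x : simplex X) :
  dim (stretch w x) = (count negb w + dim x)%N.
Proof.
by rewrite dim_sdegens size_mask ?size_map ?size_iota // count_map_negb.
Qed.

Lemma dim_Hfst (X : sset) w (x : simplex X) : (size w <= dim x)%N ->
  has negb w -> dim (Hfst w x) = (dim x).+1.
Proof.
rewrite has_count dim_stretch dim_sfaces.
by have := count_negb w; lia.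
Qed.

Lemma dim_Hsnd (X : sset) w (x : simplex X) : (size w <= dim x)%N ->
  dim (Hsnd w x) = (dim x).+1.
Proof.
rewrite dim_sdegen dim_stretch dim_sfaces count_negb_map.
by have := count_negb w; lia.
Qed.

Section Shuffles.
Variables (k : comPzRingType) (X Y Z : sset).

Lemma nabla_sassoc (x : simplex X) (u : simplex (Y \xs Z)) :
  chain_map (sassoc X Y Z) (nabla_basis k x u) =
  \sum_(v <- shuf (dim x) (dim u)) (-1) ^+ inv v *:
    tri k (stretch v x) (stretch (map negb v) (sfst u))
        (stretch (map negb v) (ssnd u)).
Proof.
rewrite nabla_basisE chain_map_comb; apply: eq_bigr => v _.
by rewrite spair_sassoc sfst_stretch ssnd_stretch.
Qed.

Lemma nabla_tri (u : simplex (X \xs Y)) (z : simplex Z) :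
  nabla_basis k u z =
  \sum_(v <- shuf (dim u) (dim z)) (-1) ^+ inv v *:
    tri k (stretch v (sfst u)) (stretch v (ssnd u)) (stretch (map negb v) z).
Proof.
rewrite nabla_basisE; apply: eq_bigr => v _.
by rewrite spair_tri sfst_stretch ssnd_stretch.
Qed.

Lemma tensZl (M N : lmodType k) a (c : M) (d : N) :
  tens (a *: c) d = a *: tens c d.
Proof.
have := tens_linear_l d a c 0.
by rewrite !addr0 (linear_at0 (tens_linear_l d)) addr0.
Qed.

Lemma first_identity (x : simplex X) (u : simplex (Y \xs Z)) :
  Htilde k (X \xs Y) Z (chain_map (sassoc X Y Z)
    (nabla k X (Y \xs Z) (tens (cls k x) (cls k u)))) =
  chain_map (sassoc X Y Z) (nabla k X (Y \xs Z)
    (koszul_tensor idfun 1%N (Htilde k Y Z) (tens (cls k x) (cls k u)))).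
Proof.
have dy := dim_sfst u; have dz := dim_ssnd u.
rewrite nablaE nabla_sassoc Htilde_comb.
transitivity (\sum_(v <- shuf (dim x) (dim u))
    \sum_(w <- Hwords (dim x + dim u))
    (-1) ^+ (inv v + ((size w).-1 + inv w))%N *:
    tri k (Hfst w (stretch v x)) (Hfst w (stretch (map negb v) (sfst u)))
      (Hsnd w (stretch (map negb v) (ssnd u)))).
  apply: eq_big_seq => v; rewrite mem_shuf => /andP[/eqP sv /eqP cv].
  have cn := count_negb v.
  rewrite Htilde_tri ?dim_stretch ?count_negb_map; try lia.
  rewrite scaler_sumr (_ : count negb v + dim x = dim x + dim u)%N; last by lia.
  by apply: eq_bigr => w _; rewrite scalerA -exprD.
rewrite (first_sum_identity k (erefl (dim x)) dy dz).
rewrite /koszul_tensor tmapE /= /gsign chain_liftE HtildeE Htilde_basisE.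
rewrite tensZl linearZ /= nabla_comb_r linearZ /= chain_map_comb mul1n.
rewrite scaler_sumr -dz; apply: eq_big_seq => w.
rewrite mem_Hwords => /andP[wn w0].
have [|u' u'y u'z] := @simplex_pair _ _ (Hfst w (sfst u)) (Hsnd w (ssnd u)).
  by rewrite dim_Hfst ?dim_Hsnd ?dim_sfst ?dim_ssnd // -dz.
rewrite -u'y -u'z spair_cls nablaE nabla_sassoc !scaler_sumr.
have -> : dim u' = (dim (ssnd u)).+1 by rewrite -dim_ssnd u'z dim_Hsnd.
by apply: eq_bigr => v _; rewrite !scalerA -!exprD u'y u'z.
Qed.

Lemma second_identity (u : simplex (X \xs Y)) (z : simplex Z) :
  Htilde k X (Y \xs Z) (chain_map (sassocV X Y Z)
    (nabla k (X \xs Y) Z (tens (cls k u) (cls k z)))) =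
  chain_map (sassocV X Y Z) (nabla k (X \xs Y) Z
    (koszul_tensor (Htilde k X Y) 0%N idfun (tens (cls k u) (cls k z)))).
Proof.
have dx := dim_sfst u; have dy := dim_ssnd u.
rewrite nablaE nabla_tri chain_map_comb Htilde_comb.
transitivity (chain_map (sassocV X Y Z)
  (\sum_(v <- shuf (dim u) (dim z)) \sum_(w <- Hwords (dim u + dim z))
    (-1) ^+ (inv v + ((size w).-1 + inv w))%N *:
    tri k (Hfst w (stretch v (sfst u))) (Hsnd w (stretch v (ssnd u)))
      (Hsnd w (stretch (map negb v) z)))).
  rewrite linear_sum /=; apply: eq_big_seq => v.
  rewrite mem_shuf => /andP[/eqP sv /eqP cv]; have cn := count_negb v.
  rewrite Htilde_triV ?dim_stretch ?count_negb_map; try lia.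
  rewrite !chain_map_comb scaler_sumr.
  rewrite (_ : count negb v + dim (sfst u) = dim u + dim z)%N; last by lia.
  by apply: eq_bigr => w _; rewrite scalerA -exprD.
rewrite (second_sum_identity k dx dy (erefl (dim z))); congr (chain_map _ _).
rewrite /koszul_tensor tmapE /= /gsign chain_liftE mul0n scale1r.
rewrite HtildeE Htilde_basisE nabla_comb_l.
apply: eq_big_seq => w; rewrite mem_Hwords => /andP[wn w0].
have [|u' u'x u'y] := @simplex_pair _ _ (Hfst w (sfst u)) (Hsnd w (ssnd u)).
  by rewrite dim_Hfst ?dim_Hsnd ?dim_sfst ?dim_ssnd.
rewrite -u'x -u'y spair_cls nablaE nabla_tri !scaler_sumr.
have -> : dim u' = (dim u).+1 by rewrite -dim_ssnd u'y dim_Hsnd dim_ssnd.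
by apply: eq_bigr => v _; rewrite !scalerA -!exprD u'x u'y.
Qed.

End Shuffles.

Theorem proposition4p6 (k : comPzRingType) (X Y Z : sset) :
  (Htilde k (X \xs Y) Z \o chain_map (sassoc X Y Z) \o nabla k X (Y \xs Z)
     =1 chain_map (sassoc X Y Z) \o nabla k X (Y \xs Z)
          \o koszul_tensor idfun 1%N (Htilde k Y Z))
  /\
  (Htilde k X (Y \xs Z) \o chain_map (sassocV X Y Z) \o nabla k (X \xs Y) Z
     =1 chain_map (sassocV X Y Z) \o nabla k (X \xs Y) Z
          \o koszul_tensor (Htilde k X Y) 0%N idfun).
Proof.
split; apply: tensor_ext; first exact: first_identity.
exact: second_identity.
Qed.
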